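(* Let $m\ge1$, $n\ge2$ and $1\le u\le v\le n-1$. Then $$F^{n}_{\alpha_{uv},m}(p,q)=\phi_{n,m}\Big(\phi_{n-1,m}\big(\cdots\phi_{v+2,m}\big(\rho\big(\phi_{v+1,m}(\cdots\phi_{v-u+3,m}(p^mq^m[m]_{p,q}^{\,v-u})\cdots)\big)\big)\cdots\big)\Big),$$ where the composition $\phi_{v+1,m}\circ\cdots\circ\phi_{v-u+3,m}$ and the composition $\phi_{n,m}\circ\cdots\circ\phi_{v+2,m}$ are interpreted as the identity when empty.
   Context: For $N\ge2$: let $e_1,\dots,e_N$ be the standard basis of $\mathbb R^N$ with standard inner product $\langle\cdot,\cdot\rangle$, $V_N=\{a\in\mathbb R^N:\sum a_i=0\}$, $\alpha_{ij}=e_i-e_{j+1}$ ($1\le i\le j\le N-1$), $\alpha_i=\alpha_{ii}$, $\theta=\alpha_{1,N-1}$, $H_{\alpha,k}=\{v\in V_N:\langle v,\alpha\rangle=k\}$. The $m$-Shi arrangement in $V_N$ is $\{H_{\alpha_{ij},k}:1\le i\le j\le N-1,\ -m<k\le m\}$; regions are connected components of the complement of the union of its hyperplanes; a region is dominant if contained in $\{v:\langle v,\alpha_i\rangle\ge0\ \forall i\}$. The fundamental alcove $A_0$ is the interior of $\{v:\langle v,\theta\rangle\le1,\langle v,\alpha_i\rangle\ge0\ \forall i\}$. A wall of a region $R$ is a hyperplane of the $m$-Shi arrangement supporting a facet of $R$; it is a separating wall if $R$ and $A_0$ lie in different closed half-spaces determined by it; a hyperplane separates $R$ from $A_0$ if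 they lie in different closed half-spaces of it. For a dominant region $R$ in $V_N$: $r(R)$ is the number of pairs $(j,k)$, $1\le j\le N-1$, $1\le k\le m$, with $H_{\alpha_{1j},k}$ separating $R$ from $A_0$; $c(R)$ is the number of pairs $(i,k)$, $1\le i\le N-1$, $1\le k\le m$, with $H_{\alpha_{i,N-1},k}$ separating $R$ from $A_0$. For $\alpha=\alpha_{ij}$ in $V_N$, $F^N_{\alpha,m}(p,q)=\sum_R p^{c(R)}q^{r(R)}$, summed over the dominant regions $R$ of the $m$-Shi arrangement in $V_N$ having $H_{\alpha,m}$ as a separating wall. Notation: $[k]_{p,q}=\sum_{j=0}^{k-1}p^jq^{k-1-j}$ and $[k]_p=\sum_{j=0}^{k-1}p^j$; for a polynomial $g=\sum_j a_j(q)p^j$, its truncation $\big[g\big]_{p\le M}=\sum_{j\le M}a_j(q)p^j$. For a polynomial $f(p,q)$ define $\phi_{k,m}(f)=\big[q^m[m(k-2)+1]_p\,f(p,q)\big]_{p\le (k-1)m}$ and $\rho(f)(p,q)=f(q,p)$. *)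

(* Defs.v *)
From HB Require Import structures.
From mathcomp Require Import all_boot all_order all_algebra.
From mathcomp Require Import polyXY.
From mathcomp Require Import all_classical all_reals all_analysis.

Import Order.TTheory GRing.Theory Num.Theory.
Import numFieldNormedType.Exports.
Local Open Scope classical_set_scope.
Local Open Scope ring_scope.

(* Basis vectors and roots carry indices starting from 1: [ebasis N i] is
   meaningful for 1 <= i <= N and [shi_root N i j] for 1 <= i <= j <= N - 1. *)

Section Geometry.
Context {R : realType}.

Definition inner {N : nat} (x y : 'rV[R]_N) : R := \sum_l x 0 l * y 0 l.

Definition ebasis (N i : nat) : 'rV[R]_N := \row_l (l.+1 == i)%:R.

Definition shi_root (N i j : nat) : 'rV[R]_N := ebasis N i - ebasis N j.+1.

Definition simple_root (N i : nat) : 'rV[R]_N := shi_root N i i.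

Definition highest_root (N : nat) : 'rV[R]_N := shi_root N 1 N.-1.

Definition Vspace (N : nat) : set 'rV[R]_N := [set a | \sum_l a 0 l = 0].

Definition hyperplane {N : nat} (a : 'rV[R]_N) (k : int) : set 'rV[R]_N :=
  [set v | Vspace N v /\ inner v a = k%:~R].

Definition halfspace_le {N : nat} (a : 'rV[R]_N) (k : int) : set 'rV[R]_N :=
  [set v | Vspace N v /\ inner v a <= k%:~R].

Definition halfspace_ge {N : nat} (a : 'rV[R]_N) (k : int) : set 'rV[R]_N :=
  [set v | Vspace N v /\ k%:~R <= inner v a].

Definition shi (N m : nat) : set (set 'rV[R]_N) :=
  [set H | exists i j : nat, exists k : int,
     [/\ (1 <= i)%N, (i <= j)%N, (j <= N.-1)%N, - m%:Z < k <= m%:Z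
       & H = hyperplane (shi_root N i j) k]].

Definition shi_complement (N m : nat) : set 'rV[R]_N :=
  Vspace N `\` \bigcup_(H in shi N m) H.

Definition shi_region (N m : nat) (A : set 'rV[R]_N) : Prop :=
  exists2 x, shi_complement N m x &
             A = connected_component (shi_complement N m) x.

Definition dominant_chamber (N : nat) : set 'rV[R]_N :=
  [set v | Vspace N v /\
     forall i : nat, (1 <= i <= N.-1)%N -> 0 <= inner v (simple_root N i)].

Definition dominant_region (N m : nat) (A : set 'rV[R]_N) : Prop :=
  shi_region N m A /\ A `<=` dominant_chamber N.

Definition closed_fund_alcove (N : nat) : set 'rV[R]_N :=
  [set v | dominant_chamber N v /\ inner v (highest_root N) <= 1].

(* The interior is taken in V_N: the interior in R^N would be empty. *)
Definition fund_alcove (N : nat) : set 'rV[R]_N :=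
  @interior (subspace (Vspace N)) (closed_fund_alcove N).

Definition separates {N : nat} (a : 'rV[R]_N) (k : int)
    (A B : set 'rV[R]_N) : Prop :=
  (A `<=` halfspace_le a k /\ B `<=` halfspace_ge a k) \/
  (A `<=` halfspace_ge a k /\ B `<=` halfspace_le a k).

Definition affine_hull {N : nat} (A : set 'rV[R]_N) : set 'rV[R]_N :=
  [set x | exists (d : nat) (y : 'I_d -> 'rV[R]_N) (c : 'I_d -> R),
     [/\ forall t, A (y t), \sum_t c t = 1 & x = \sum_t c t *: y t]].

(* The face cut out on the closure of A by a supporting hyperplane is a facet
   (a face of codimension one) when its affine span is the whole hyperplane. *)
Definition supports_facet {N : nat} (a : 'rV[R]_N) (k : int)
    (A : set 'rV[R]_N) : Prop :=
  (A `<=` halfspace_le a k \/ A `<=` halfspace_ge a k) /\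
  affine_hull (closure A `&` hyperplane a k) = hyperplane a k.

Definition wall {N : nat} (m : nat) (a : 'rV[R]_N) (k : int)
    (A : set 'rV[R]_N) : Prop :=
  shi N m (hyperplane a k) /\ supports_facet a k A.

Definition separating_wall {N : nat} (m : nat) (a : 'rV[R]_N) (k : int)
    (A : set 'rV[R]_N) : Prop :=
  wall m a k A /\ separates a k A (fund_alcove N).

Definition r_stat (N m : nat) (A : set 'rV[R]_N) : nat :=
  (\sum_(1 <= j < N) \sum_(1 <= k < m.+1)
     `[< separates (shi_root N 1 j) k%:Z A (fund_alcove N) >])%N.

Definition c_stat (N m : nat) (A : set 'rV[R]_N) : nat :=
  (\sum_(1 <= i < N) \sum_(1 <= k < m.+1)
     `[< separates (shi_root N i N.-1) k%:Z A (fund_alcove N) >])%N.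

End Geometry.

(* Polynomials in p and q are elements of Z[q][p]: the outer variable is p and
   the coefficients are polynomials in q. *)
Notation pqpoly := {poly {poly int}}.

Definition pvar : pqpoly := 'X.
Definition qvar : pqpoly := 'X%:P.

Definition genF (R : realType) (N m i j : nat) : pqpoly :=
  \sum_(A \in [set A : set 'rV[R]_N |
                dominant_region N m A /\
                separating_wall m (shi_root N i j) m%:Z A])
     (pvar ^+ c_stat N m A * qvar ^+ r_stat N m A).

Definition bracket_pq (k : nat) : pqpoly :=
  \sum_(j < k) pvar ^+ j * qvar ^+ (k.-1 - j).

Definition bracket_p (k : nat) : pqpoly := \sum_(j < k) pvar ^+ j.

Definition truncp (M : nat) (g : pqpoly) : pqpoly := take_poly M.+1 g.

Definition phi (k m : nat) (f : pqpoly) : pqpoly :=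
  truncp ((k - 1) * m) (qvar ^+ m * bracket_p (m * (k - 2) + 1) * f).

Definition rho (f : pqpoly) : pqpoly := swapXY f.

(* phi_{b,m} o ... o phi_{a,m}, with phi_{a,m} applied first; it is the
   identity when b < a. *)
Definition phi_comp (m a b : nat) (f : pqpoly) : pqpoly :=
  foldl (fun g k => phi k m g) f (index_iota a b.+1).

(* Main.v *)
Require Import Defs.
From mathcomp Require Import all_boot all_order all_algebra all_fingroup polyXY.
From mathcomp Require Import all_classical all_reals all_analysis.
From mathcomp Require Import zify ring lra.

(** Write [x_0 > ... > x_M] for the coordinates of a point of a dominant region.
    The region is the set of points for which the inequalities [x_i - x_j > k]
    ([i < j], [0 < k <= m]) have prescribed truth values, and it determines the
    order of the shifted coordinates [x_i - k].  Hence the regions in rank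
    [M + 1] lying over a given region in rank [M] are indexed by the position of
    [x_(M+1)] among the values [x_i - k], [i <= M], [0 < k <= m], and this
    position is exactly the statistic [c]; it ranges over all integers between
    the old value of [c] and [m (M + 1)].

    The hyperplane [x_a - x_b = m] is a separating wall precisely when no
    [x_t - k] lies between [x_b] and [x_a - m], a condition on [x_a, ..., x_b]
    only.  Adding a last coordinate to a region with this wall multiplies the
    generating function by [phi], because [x_0 - x_(M+1) > m] forces [r] to grow
    by [m].  Adding coordinates on the left is the same up to the symmetry
    [x_i |-> - x_(M-i)], which exchanges [c] and [r].

    This leaves the wall [x_0 - x_M = m] in rank [M].  There the coordinates
    [x_1, ..., x_(M-1)] lie in an interval of length [m] below [x_0], and the
    region is encoded by the word listing the integral parts of the distances
    [x_0 - x_i] in the order of their fractional parts; all words of length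
    [M - 1] over [m] letters occur, whence the power of [bracket_pq m]. *)

Import Order.TTheory GRing.Theory Num.Theory.
Import numFieldNormedType.Exports.
Local Open Scope classical_set_scope.
Local Open Scope ring_scope.
Set Implicit Arguments.
Unset Strict Implicit.
Unset Printing Implicit Defensive.

(** * Sums over classes *)

Section ClassSum.
Variable V : nmodType.

(** Regions are handled through points and a code in a finite type. The value at a code is read off
    at a chosen point, so no quotient has to be formed; codes that are not attained contribute 0. *)
Definition class_val (X : Type) (T : finType) (f : X -> T) (Q : X -> Prop)
    (w : X -> V) (t : T) : V :=
  if pselect (exists x, Q x /\ f x = t) is left h then w (sval (cid h)) else 0.

(* The sum of [w] over the fibres of [f] that meet [Q]; it is only meaningful
   when [w] is constant on the intersection of [Q] with each fibre. *)
Definition class_sum X (T : finType) (f : X -> T) Q w : V :=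
  \sum_(t : T) class_val f Q w t.

Definition class_invariant X (T : finType) (f : X -> T) (Q : X -> Prop) (w : X -> V) :=
  forall x z, Q x -> Q z -> f x = f z -> w x = w z.

Lemma class_valE X (T : finType) (f : X -> T) Q w x :
  class_invariant f Q w -> Q x -> class_val f Q w (f x) = w x.
Proof.
move=> wP Qx; rewrite /class_val; case: pselect => [h|[]]; last by exists x.
by case: (cid h) => z /= [Qz fz]; exact: wP.
Qed.

Lemma class_val_out X (T : finType) (f : X -> T) Q w t :
  ~ (exists x, Q x /\ f x = t) -> class_val f Q w t = 0.
Proof. by rewrite /class_val; case: pselect. Qed.

(** The map [g] on points induces a bijection between the attained codes: the equivalence of code
    equalities makes it well defined and injective, the last hypothesis makes it surjective. *)
Lemma class_sum_reindex X X' (T T' : finType) (f : X -> T) (f' : X' -> T')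
    (Q : X -> Prop) (Q' : X' -> Prop) w w' (g : X -> X') :
  class_invariant f' Q' w' ->
  (forall x, Q x -> Q' (g x)) ->
  (forall x, Q x -> w x = w' (g x)) ->
  (forall x z, Q x -> Q z -> f x = f z <-> f' (g x) = f' (g z)) ->
  (forall y, Q' y -> exists2 x, Q x & f' (g x) = f' y) ->
  class_sum f Q w = class_sum f' Q' w'.
Proof.
move=> w'P QQ' ww' ff' surj.
have wP : class_invariant f Q w.
  move=> x z Qx Qz fxz; rewrite !ww' //; apply: w'P; [exact: QQ'|exact: QQ'|].
  exact/ff'.
pose A := [set t | `[< exists x, Q x /\ f x = t >]]%SET.
pose A' := [set t | `[< exists x, Q' x /\ f' x = t >]]%SET.
have sumE Y (S : finType) (h : Y -> S) P u :
    class_sum h P u = \sum_(t in [set t | `[< exists x, P x /\ h x = t >]]%SET)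
                        class_val h P u t.
  rewrite /class_sum [RHS]big_mkcond; apply: eq_bigr => t _; rewrite inE.
  by case: asboolP => // none; rewrite class_val_out.
rewrite !sumE -/A -/A'.
(* An attained code [t0'] serves as default value to make the induced map on codes total. If there
   is none, both sums are empty. *)
case: (pselect (exists t, t \in A')) => [[t0' t0'A]|A'0]; last first.
  rewrite !big_pred0 // => t; apply/negP => tA.
    by apply: A'0; exists t.
  apply: A'0; move: tA; rewrite inE => /asboolP [x [Qx _]].
  by exists (f' (g x)); rewrite inE; apply/asboolP; exists (g x); split; first exact: QQ'.
pose h t := if pselect (exists x, Q x /\ f x = t) is left e
            then f' (g (sval (cid e))) else t0'.
have hE x : Q x -> h (f x) = f' (g x).
  move=> Qx; rewrite /h; case: pselect => [e|[]]; last by exists x.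
  by case: (cid e) => z /= [Qz fz]; apply/ff'.
have -> : A' = (h @: A)%SET.
  apply/setP => t'; apply/idP/imsetP.
    rewrite inE => /asboolP [y [Q'y <-]].
    have [x Qx <-] := surj y Q'y.
    by exists (f x); rewrite ?hE // inE; apply/asboolP; exists x.
  move=> [t]; rewrite inE => /asboolP [x [Qx <-]] ->; rewrite hE // inE.
  by apply/asboolP; exists (g x); split; first exact: QQ'.
rewrite big_imset /=; last first.
  move=> t z; rewrite inE => /asboolP [x [Qx <-]].
  rewrite inE => /asboolP [y [Qy <-]].
  by rewrite !hE // => ?; apply/ff'.
apply: eq_bigr => t; rewrite inE => /asboolP [x [Qx <-]].
by rewrite hE // !class_valE //; [exact: ww'|exact: QQ'].
Qed.

End ClassSum.

(** * Thresholds among finitely many real values *)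

Section FinitePoints.
Variables (R : realFieldType) (I : finType) (v : I -> R).

Definition above (y : R) : {set I} := [set i | y < v i]%SET.

Lemma gap_below (M : R) : exists2 y, y < M & forall i, v i < M -> v i < y.
Proof.
pose e := \big[Num.max/(M - 1)]_(i | v i < M) v i.
have eM : e < M by rewrite /e; elim/big_ind: _ => [|a b aM bM|i //];
  rewrite ?gt_max ?aM ?bM //; lra.
exists ((e + M) / 2); first by lra.
move=> i viM; suff : v i <= e by lra.
by rewrite /e (bigD1 i) //= le_max lexx.
Qed.

Hypothesis v_inj : injective v.

(** Lowering the threshold just past the largest value below it raises the count by exactly one,
    since the values are distinct. The induction is on the number of values still to be passed. *)
Lemma pick_below (M : R) (c : nat) :
  (forall i, v i != M) -> (#|above M| <= c)%N -> (c <= #|I|)%N ->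
  exists y, [/\ y < M, forall i, v i != y & #|above y| = c].
Proof.
move: {2}(c - _)%N (leqnn (c - #|above M|)%N) => d.
elim: d M => [|d IH] M dE vM Mc cI.
  have [y yM gap] := gap_below M; exists y; split=> //.
    by move=> i; apply/eqP => viy; have := gap i; rewrite viy ltxx => /(_ yM).
  have -> : above y = above M.
    apply/setP => i; rewrite !inE; have := gap i; have := vM i.
    by case: (ltgtP (v i) M) => [viM _ /(_ isT)| |] //; lra.
  by apply/eqP; rewrite eqn_leq Mc; lia.
have [cE|cM] := eqVneq c #|above M|.
  by apply: IH => //; rewrite cE subnn.
have {}cM : (#|above M| < c)%N by rewrite ltn_neqAle eq_sym cM.
have [i0 i0M] : exists i, v i < M.
  case: (pickP (fun i => v i < M)) => [i iM|noi]; first by exists i.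
  suff : #|above M| = #|I| by lia.
  rewrite -cardsT; congr #|pred_of_set _|; apply/setP => i; rewrite !inE.
  by have := noi i; have := vM i; case: ltgtP.
pose i1 := [arg max_(i > i0 | v i < M) v i]%O.
have [i1M i1max] : v i1 < M /\ forall j, v j < M -> v j <= v i1.
  by rewrite /i1; case: arg_maxP.
have [y yi1 gap] := gap_below (v i1).
have ups : above y = (i1 |: above M)%SET.
  apply/setP => i; rewrite !inE; case: (eqVneq i i1) => [->//|ii1] /=.
  have := vM i; have := gap i; have := i1max i.
  case: (ltgtP (v i) M) => //.
    move=> _ /(_ isT); rewrite le_eqVlt => /orP [/eqP/v_inj/eqP|vlt /(_ vlt)].
      by rewrite (negPf ii1).
    by lra.
  by move=> *; lra.
have upc : #|above y| = #|above M|.+1.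
  by rewrite ups cardsU1 inE (_ : (M < v i1) = false) //; apply/negP; lra.
have [||||z [zy zv zc]] := IH y.
- by rewrite upc; lia.
- move=> i; apply/eqP => viy; have := gap i; rewrite viy ltxx => /(_ yi1).
  by [].
- by rewrite upc.
- by [].
by exists z; split=> //; lra.
Qed.

End FinitePoints.

(** * Generic points and the insertion of a coordinate *)

Section Points.
Variables (R : realType) (m : nat).
Implicit Types (x z : nat -> R) (M : nat).

(** Strictly decreasing coordinates avoid every hyperplane of negative level or level 0, so only
    natural levels are listed. *)
Definition generic M x := forall i j, (i < j <= M)%N ->
  x j < x i /\ forall k, (k <= m)%N -> x i != x j + k%:R.

(** The bound [l] is a parameter because a region is described by the levels up to [m], whereas the
    order of the shifted coordinates depends only on the levels up to [m - 1]. *)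
Definition same_side l M x z := forall i j k, (i < j <= M)%N -> (0 < k <= l)%N ->
  (x j + k%:R < x i) = (z j + k%:R < z i).

Definition shifts M x (p : 'I_M * 'I_m) : R := x p.1 - p.2.+1%:R.

Definition ccount M x : nat := #|above (shifts (M := M) x) (x M)|.

Definition rcount M x : nat :=
  #|[set p : 'I_M * 'I_m | x (lift ord0 p.1) + p.2.+1%:R < x 0%N]%SET|.

(** Points are functions on [nat] of which only an initial part matters, so adding a coordinate does
    not change their type. *)
Definition update x (j : nat) (y : R) : nat -> R := fun i => if i == j then y else x i.

Lemma genericS M N x : (M <= N)%N -> generic N x -> generic M x.
Proof. by move=> MN gx i j /andP [ij jM]; apply: gx; rewrite ij (leq_trans jM). Qed.

Lemma same_sideW l l' M N x z : (l <= l')%N -> (M <= N)%N ->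
  same_side l' N x z -> same_side l M x z.
Proof.
move=> ll MN s i j k /andP [ij jM] /andP [k0 kl]; apply: s.
  by rewrite ij (leq_trans jM).
by rewrite k0 (leq_trans kl).
Qed.

Lemma same_side_sym l M x z : same_side l M x z -> same_side l M z x.
Proof. by move=> s i j k ij k0; rewrite s. Qed.

Lemma same_side_trans l M x y z :
  same_side l M x y -> same_side l M y z -> same_side l M x z.
Proof. by move=> s1 s2 i j k ij k0; rewrite s1 // s2. Qed.

Lemma same_side0 l M x z i j k : generic M x -> generic M z -> same_side l M x z ->
  (i < j <= M)%N -> (k <= l)%N -> (x j + k%:R < x i) = (z j + k%:R < z i).
Proof.
move=> gx gz s ij; case: k => [|k] kl; last exact: s.
by rewrite !addr0 (proj1 (gx _ _ ij)) (proj1 (gz _ _ ij)).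
Qed.

Lemma generic_lt M x i j k : generic M x -> (i < j <= M)%N -> (k <= m)%N ->
  (x i < x j + k%:R) = ~~ (x j + k%:R < x i).
Proof. by move=> gx ij km; have [_ /(_ _ km)] := gx _ _ ij; case: ltgtP. Qed.

(** The shifts run from 1 to [m], so comparing two of them compares a difference of coordinates with
    a level of absolute value at most [m - 1]. For the levels on which [same_side] is silent,
    monotonicity decides. *)
Lemma shifts_lt M x z (p q : 'I_M.+1 * 'I_m) : generic M x -> generic M z ->
  same_side m.-1 M x z -> (shifts x p < shifts x q) = (shifts z p < shifts z q).
Proof.
case: p q => [[i iM] [k km]] [[j jM] [l lm]] gx gz s; rewrite /shifts /=.
have lr (a b : nat) : (a <= b)%N -> (a%:R <= b%:R :> R) by rewrite ler_nat.
have E (y : nat -> R) (a b c d : nat) :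
    (y a - c.+1%:R < y b - d.+1%:R) = (y a + d%:R < y b + c%:R).
  by apply/idP/idP; rewrite -(natr1 c) -(natr1 d); lra.
rewrite !E; case: (ltngtP i j) => [ij|ji|->]; last first.
- by rewrite !ltrD2l.
- have h : (j < i <= M)%N by rewrite ji.
  have [kl|lk] := leqP l k.
    have := lr _ _ kl; have [x1 _] := gx _ _ h; have [z1 _] := gz _ _ h.
    by move=> ?; transitivity true; [|symmetry]; lra.
  have := s j i (l - k)%N h; rewrite natrB; last exact: ltnW.
  have -> : (0 < l - k <= m.-1)%N by lia.
  by move=> /(_ isT) e; apply/idP/idP => ?; [have : x i + (l%:R - k%:R) < x j by lra
    |have : z i + (l%:R - k%:R) < z j by lra]; rewrite ?e -?e; lra.
- have h : (i < j <= M)%N by rewrite ij.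
  have [kl|lk] := leqP k l.
    have := lr _ _ kl; have [x1 _] := gx _ _ h; have [z1 _] := gz _ _ h.
    by move=> ?; transitivity false; [|symmetry]; apply/negP; lra.
  have hk : (k - l <= m)%N by lia.
  have := s i j (k - l)%N h; have := generic_lt gx h hk; have := generic_lt gz h hk.
  rewrite natrB; last exact: ltnW.
  have -> : (0 < k - l <= m.-1)%N by lia.
  move=> ez ex /(_ isT) e.
  have -> : (x i + l%:R < x j + k%:R) = (x i < x j + (k%:R - l%:R)).
    by apply/idP/idP; lra.
  have -> : (z i + l%:R < z j + k%:R) = (z i < z j + (k%:R - l%:R)).
    by apply/idP/idP; lra.
  by rewrite ex ez e.
Qed.

Lemma shifts_inj M x : generic M x -> injective (shifts (M := M.+1) x).
Proof.
move=> gx [i k] [j l]; rewrite /shifts /= => E.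
have [ij|ij] := eqVneq i j.
  subst j; have : k.+1%:R = l.+1%:R :> R by lra.
  by move/eqP; rewrite eqr_nat eqSS => /eqP /val_inj ->.
wlog ij' : i j k l E ij / (i < j)%N.
  move=> W; have [ij'|] := ltnP i j; first exact: W.
  rewrite leq_eqVlt eq_sym val_eqE (negPf ij) /= => ji.
  by symmetry; apply: (W) => //; rewrite eq_sym.
have h : (i < j <= M)%N by rewrite ij' -ltnS ltn_ord.
have [lt /(_ (k - l)%N)] := gx _ _ h.
have kl : (l < k)%N.
  by rewrite -(ltr_nat R); move: E lt; rewrite -(natr1 k) -(natr1 l); lra.
rewrite natrB; last exact: ltnW.
have -> : (k - l <= m)%N by rewrite (leq_trans (leq_subr _ _)) // ltnW.
by move=> /(_ isT) /eqP []; move: E; rewrite -(natr1 k) -(natr1 l); lra.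
Qed.

(* Two upper sets of a totally ordered finite set are nested, so they are equal
   as soon as they have the same cardinal. *)
Lemma above_inj (I : finType) (v v' : I -> R) (a b : R) :
  (forall p q, (v p < v q) = (v' p < v' q)) -> #|above v a| = #|above v' b| ->
  above v a = above v' b.
Proof.
move=> vv cE; apply/eqP.
have [sub|/subsetPn [p]] := boolP (above v a \subset above v' b).
  by rewrite eqEcard sub cE /=.
have [sub|/subsetPn [q]] := boolP (above v' b \subset above v a).
  by rewrite eq_sym eqEcard sub cE /=.
rewrite !inE => bq aq ap bp; have := vv q p.
have -> : v q < v p by lra.
by move/esym; lra.
Qed.

Lemma in_above_shifts M x (i k : nat) (y : R) (iM : (i < M)%N) (km : (k < m)%N) :
  ((Ordinal iM, Ordinal km) \in above (shifts (M := M) x) y) = (y + k.+1%:R < x i).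
Proof. by rewrite inE /shifts /= ltrBrDr. Qed.

(** The shifts of [x] and of [z] are ordered alike, and the shifts above a threshold form an upper
    set, which its cardinal determines. Thus a new last coordinate is described by a single
    number. *)
Lemma column_unique M x z a b : generic M x -> generic M z ->
  same_side m.-1 M x z ->
  #|above (shifts (M := M.+1) x) a| = #|above (shifts (M := M.+1) z) b| ->
  forall i k, (i <= M)%N -> (0 < k <= m)%N -> (a + k%:R < x i) = (b + k%:R < z i).
Proof.
move=> gx gz s cE i [//|k] iM km.
have iM' : (i < M.+1)%N by [].
have E := above_inj (fun p q => shifts_lt p q gx gz s) cE.
by rewrite -!(in_above_shifts _ _ iM' km) E.
Qed.

Lemma update_generic M z y : generic M z -> y < z M ->
  (forall p, shifts (M := M.+1) z p != y) -> generic M.+1 (update z M.+1 y).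
Proof.
move=> gz yz yp i j /andP [ij jM]; rewrite /update (ltn_eqF (leq_trans ij jM)).
have [jM1|jM1] := eqVneq j M.+1; last first.
  by apply: gz; rewrite ij -ltnS ltn_neqAle jM1.
subst j; have yi : y < z i.
  move: ij; rewrite ltnS leq_eqVlt => /orP [/eqP -> //|iM].
  by have [] := gz i M; rewrite ?iM ?leqnn //; lra.
split=> // - [|k] km; first by rewrite addr0 gt_eqF.
by have := yp (Ordinal ij, Ordinal km); rewrite /shifts /= subr_eq.
Qed.

Lemma extend_count M z c : generic M z -> (ccount M z <= c <= m * M.+1)%N ->
  exists y, generic M.+1 (update z M.+1 y) /\
    #|above (shifts (M := M.+1) z) y| = c.
Proof.
move=> gz /andP [c1 c2].
have [|||y [yz yp yc]] := @pick_below _ _ _ (shifts_inj gz) (z M) c.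
- move=> [[i iM] [k km]]; rewrite /shifts /=.
  have [->|iM'] := eqVneq i M; first by rewrite lt_eqF // ltrBlDr ltrDl ltr0n.
  have {}iM : (i < M)%N by rewrite ltn_neqAle iM'.
  by have [|_ /(_ k.+1 km)] := gz i M; rewrite ?iM ?leqnn ?subr_eq.
(* The shifts of coordinate [M] itself lie below [z M], so those above [z M] come from earlier
   coordinates and are counted by [ccount M z]. *)
- apply: leq_trans c1; rewrite /ccount.
  pose h (p : 'I_M * 'I_m) := (widen_ord (leqnSn M) p.1, p.2).
  have hinj : injective h.
    by move=> [i k] [j l] [] ij ->; congr (_, _); apply: val_inj.
  rewrite -(card_imset _ hinj); apply: subset_leq_card; apply/fintype.subsetP.
  move=> [[i iM] k]; rewrite inE /shifts /= => lt.
  have iM' : (i < M)%N.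
    rewrite ltn_neqAle -ltnS iM andbT; apply: contraTneq lt => ->.
    by rewrite ltrBrDr gtrDl ltrn0.
  by apply/imsetP; exists (Ordinal iM', k); rewrite ?inE //; congr (_, _); apply: val_inj.
- by rewrite card_prod !card_ord mulnC.
by exists y; split=> //; exact: update_generic.
Qed.

Lemma ccount_update M z y : ccount M.+1 (update z M.+1 y) = #|above (shifts (M := M.+1) z) y|.
Proof.
rewrite /ccount {2}/update eqxx; congr #|pred_of_set _|; apply/setP => [[[i iM] k]].
by rewrite !inE /shifts /update /= (ltn_eqF iM).
Qed.

Lemma ccount_mono M x : generic M.+1 x -> (ccount M x <= ccount M.+1 x)%N.
Proof.
move=> gx; rewrite /ccount.
pose h (p : 'I_M * 'I_m) := (widen_ord (leqnSn M) p.1, p.2).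
have hinj : injective h.
  by move=> [i k] [j l] [] ij ->; congr (_, _); apply: val_inj.
rewrite -(card_imset _ hinj); apply: subset_leq_card; apply/fintype.subsetP => _ /imsetP [p + ->].
rewrite !inE; have [|xM _] := gx M M.+1; first by rewrite !leqnn.
by rewrite /shifts /= => ?; lra.
Qed.

Lemma ccount_le M x : (ccount M x <= m * M)%N.
Proof. by apply: leq_trans (max_card _) _; rewrite card_prod !card_ord mulnC. Qed.

Lemma ccount_leq M x z :
  (forall i k, (i < M)%N -> (0 < k <= m)%N -> x M + k%:R < x i -> z M + k%:R < z i) ->
  (ccount M x <= ccount M z)%N.
Proof.
move=> h; apply: subset_leq_card; apply/fintype.subsetP => [[[i iM] [k km]]].
by rewrite !in_above_shifts; apply: h.
Qed.

(** Used to carry later coordinates across a wall: [x] and [z] may differ at level [m]. The last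
    hypothesis gives [ccount M z <= ccount M x], so the count needed for the new coordinate is
    available over [z]. *)
Lemma extend_same M x z : generic M.+1 x -> generic M z -> same_side m.-1 M x z ->
  (forall i k, (i < M)%N -> (0 < k <= m)%N -> z M + k%:R < z i -> x M + k%:R < x i) ->
  exists y, generic M.+1 (update z M.+1 y) /\
    forall i k, (i <= M)%N -> (0 < k <= m)%N ->
      (x M.+1 + k%:R < x i) = (y + k%:R < z i).
Proof.
move=> gx gz s zx.
have [|y [gy yc]] := @extend_count M z (ccount M.+1 x) gz.
  by rewrite ccount_le andbT (leq_trans (ccount_leq zx)) // ccount_mono.
exists y; split=> //; apply: column_unique => //; exact: genericS gx.
Qed.

End Points.

(** * The recursion and the reflection *)

Section PhiMonomial.

Lemma coef_sumXn (A : nzRingType) (a L i : nat) :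
  (\sum_(a <= c < a + L) 'X^c : {poly A})`_i = (a <= i < a + L)%N%:R.
Proof.
elim: L => [|L IH].
  by rewrite addn0 big_geq // coef0; case: ltngtP.
rewrite addnS big_nat_recr ?leq_addr //= coefD IH coefXn.
case: (ltngtP i (a + L)%N) => [lt|lt|->].
- by rewrite addr0; congr (nat_of_bool _)%:R; lia.
- by rewrite addr0; congr (nat_of_bool _)%:R; lia.
- by rewrite andbF add0r leq_addr ltnSn.
Qed.

(** The bracket spreads the exponent of p over [c], ..., [c + m * M]. Since [m <= c], this range
    reaches the truncation bound [m * M.+1], so the bound alone determines where the sum stops. *)
Lemma phi_monomial (M m c r : nat) : (m <= c <= m * M.+1)%N ->
  phi M.+2 m (pvar ^+ c * qvar ^+ r) =
  \sum_(d < (m * M.+1).+1 | (c <= d)%N) pvar ^+ d * qvar ^+ (r + m).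
Proof.
move=> /andP [mc cM]; rewrite /phi /truncp /pvar /qvar /bracket_p.
have -> : 'X%:P ^+ m * (\sum_(j < m * (M.+2 - 2) + 1) 'X^j) * ('X^c * 'X%:P ^+ r) =
    'X^(r + m) *: \sum_(c <= d < c + (m * M).+1) 'X^d :> pqpoly.
  rewrite -mul_polyC [(r + m)%N]addnC exprD polyCM !polyC_exp -!mulrA; congr (_ * _).
  rewrite mulrA mulrC; congr (_ * _).
  rewrite mulrC addn1 subn2 /= -[X in index_iota X]add0n [(c + _)%N]addnC big_addn addnK big_mkord.
  by rewrite big_distrr; apply: eq_bigr => i _; rewrite /= -exprD addnC.
rewrite (_ : \sum_(d < _ | _) _ = 'X^(r + m) *: \sum_(c <= d < c + ((m * M.+1).+1 - c)) 'X^d).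
  rewrite take_polyZ; congr (_ *: _); apply/polyP => i.
  rewrite coef_take_poly !coef_sumXn; case: ifP => h.
    by congr (nat_of_bool _)%:R; lia.
  by rewrite (_ : (_ && _) = false) //; lia.
rewrite subnKC; last by lia.
rewrite scaler_sumr -(big_mkord (fun d => c <= d)%N (fun d => 'X^d * 'X%:P ^+ (r + m))).
rewrite [RHS](big_nat_widenl c 0%N) // [LHS]big_mkcond [RHS]big_mkcond; apply: eq_bigr => i _.
by case: ifP => //= _; rewrite -mul_polyC polyC_exp mulrC.
Qed.

Lemma phi_sum (I : finType) (k m : nat) (F : I -> pqpoly) :
  phi k m (\sum_i F i) = \sum_i phi k m (F i).
Proof. by rewrite /phi /truncp mulr_sumr take_poly_sum. Qed.

Lemma phi0 k m : phi k m 0 = 0.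
Proof. by rewrite /phi /truncp mulr0 take_poly0r. Qed.

Lemma phi_comp_recr m a b f : (a <= b.+1)%N ->
  phi_comp m a b.+1 f = phi b.+1 m (phi_comp m a b f).
Proof.
move=> ab; rewrite /phi_comp /index_iota subSn //.
by rewrite -addn1 iotaD foldl_cat subnKC.
Qed.

Lemma phi_comp_nil m a b f : (b < a)%N -> phi_comp m a b f = f.
Proof. by move=> ba; rewrite /phi_comp /index_iota (eqP ba). Qed.

Lemma rho_monomial (a b : nat) : rho (pvar ^+ a * qvar ^+ b) = pvar ^+ b * qvar ^+ a.
Proof. by rewrite /rho /pvar /qvar rmorphM !rmorphXn /= swapXY_X swapXY_Y mulrC. Qed.

End PhiMonomial.

Section Recursions.
Variables (R : realType) (m : nat).
Implicit Types (x z : nat -> R) (M : nat).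

(** The inequalities x_a - x_t > k and x_t - x_b > m - k add up to x_a - x_b > m. The second clause
    excludes every such pair, so that x_a - x_b > m is not a consequence of them. *)
Definition has_wall a b x := x b + m%:R < x a /\
  forall t k, (a < t < b)%N -> (k <= m)%N -> x t + k%:R < x a ->
  ~~ (x b + (m - k)%:R < x t).

(** A finite code for the region of a generic point. The conjunct on the indices keeps the entries
    with i >= j from carrying information. *)
Definition tab M x : {set 'I_M.+1 * 'I_M.+1 * 'I_m} :=
  [set t : 'I_M.+1 * 'I_M.+1 * 'I_m
     | (t.1.1 < t.1.2)%N && (x t.1.2 + t.2.+1%:R < x t.1.1)]%SET.

Definition walled M a b x := generic m M x /\ has_wall a b x.

Definition weight M x : pqpoly := pvar ^+ ccount m M x * qvar ^+ rcount m M x.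

Definition wall_sum M a b : pqpoly := class_sum (tab M) (walled M a b) (weight M).

Lemma tabP M x z : tab M x = tab M z <-> same_side m M x z.
Proof.
split=> [/setP E i j k /andP [ij jM] /andP [k0 km]|s].
  case: k k0 km => // k _ km.
  have iM : (i < M.+1)%N by rewrite ltnS (leq_trans (ltnW ij)).
  by have := E (Ordinal iM, Ordinal (jM : j < M.+1)%N, Ordinal km); rewrite !inE /= ij.
apply/setP => [[[i j] k]]; rewrite !inE /=; case: ltnP => //= ij.
by rewrite s // ?ij -1?ltnS //= ltn_ord.
Qed.

Lemma ccountE M x :
  ccount m M x = (\sum_(i < M) \sum_(k < m) (x M + k.+1%:R < x i)%R)%N.
Proof.
rewrite /ccount -sum1_card big_mkcond /= pair_big /=; apply: eq_bigr => [[i k] _].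
by rewrite inE /shifts /= ltrBrDr; case: ifP.
Qed.

Lemma rcountE M x :
  rcount m M x = (\sum_(j < M) \sum_(k < m) (x j.+1 + k.+1%:R < x 0%N)%R)%N.
Proof.
rewrite /rcount -sum1_card big_mkcond /= pair_big /=; apply: eq_bigr => [[i k] _].
by rewrite inE /=; case: ifP.
Qed.

Lemma ccount_same M x z : same_side m M x z -> ccount m M x = ccount m M z.
Proof.
move=> s; rewrite !ccountE; apply: eq_bigr => i _; apply: eq_bigr => k _.
by rewrite s // ltn_ord ?leqnn.
Qed.

Lemma rcount_same M x z : same_side m M x z -> rcount m M x = rcount m M z.
Proof.
move=> s; rewrite !rcountE; apply: eq_bigr => i _; apply: eq_bigr => k _.
by rewrite s // !ltn_ord.
Qed.

Lemma weight_same M x z : same_side m M x z -> weight M x = weight M z.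
Proof. by move=> s; rewrite /weight (ccount_same s) (rcount_same s). Qed.

Lemma weight_invariant M Q : class_invariant (tab M) Q (weight M).
Proof. by move=> x z _ _ /tabP; exact: weight_same. Qed.

Lemma generic_le M x i j : generic m M x -> (i <= j <= M)%N -> x j <= x i.
Proof.
move=> gx /andP []; rewrite leq_eqVlt => /orP [/eqP -> //|ij jM].
by have [|/ltW] := gx i j; rewrite ?ij.
Qed.

(** As x_M <= x_b < x_a - m, the index [a] alone contributes all [m] levels. This supplies the lower
    bound on the exponent in [phi_monomial]. *)
Lemma wall_ccount M a b x : (a < b <= M)%N -> walled M a b x -> (m <= ccount m M x)%N.
Proof.
move=> /andP [ab bM] [gx [w _]]; rewrite ccountE (bigD1 (Ordinal (leq_trans ab bM))) //=.
apply: leq_trans (leq_addr _ _).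
rewrite -{1}[m]muln1 -{1}(card_ord m) -sum_nat_const; apply: leq_sum => k _.
have := @generic_le M x b M gx; rewrite bM leqnn => /(_ isT) xM.
have km : k.+1%:R <= m%:R :> R by rewrite ler_nat ltn_ord.
by rewrite (_ : (_ < _)%R = true) //; lra.
Qed.

Lemma wall_rcount M a b x : (a < b <= M)%N -> walled M.+1 a b x ->
  rcount m M.+1 x = (rcount m M x + m)%N.
Proof.
move=> /andP [ab bM] [gx [w _]]; rewrite !rcountE big_ord_recr /=; congr (_ + _)%N.
rewrite -[RHS]muln1 -[X in (X * _)%N](card_ord m) -sum_nat_const; apply: eq_bigr => k _.
have := @generic_le M.+1 x b M.+1 gx; rewrite leqnn (leq_trans bM) // => /(_ isT) xM.
have := @generic_le M.+1 x 0%N a gx; rewrite leq0n (leq_trans (ltnW ab)) ?(leq_trans bM) //.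
move=> /(_ isT) x0; have km : k.+1%:R <= m%:R :> R by rewrite ler_nat ltn_ord.
by rewrite (_ : (_ < _)%R = true) //; lra.
Qed.

Lemma has_wall_ext b a x z : (forall i, (i <= b)%N -> x i = z i) -> (a < b)%N ->
  has_wall a b x -> has_wall a b z.
Proof.
move=> E ab [w1 w2]; split; first by rewrite -!E // ltnW.
move=> t k /andP [at_ tb] km; rewrite -!E ?(ltnW ab) ?(ltnW tb) //.
by apply: w2; rewrite // at_ tb.
Qed.

Lemma same_side_ext l M x z : (forall i, (i <= M)%N -> x i = z i) -> same_side l M x z.
Proof.
move=> E i j k /andP [ij jM] _; rewrite !E //.
exact: leq_trans (ltnW ij) jM.
Qed.

Lemma updateE x j y i : (i < j)%N -> update x j y i = x i.
Proof. by rewrite /update => /ltn_eqF ->. Qed.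

(** The wall concerns only coordinates up to [b], so it is kept when a last coordinate is added.
    Regions upstairs correspond to pairs of a region below and a value of c between the old one and
    [m * M.+1]; summing over that value is [phi_monomial]. The index is [M.+2] because indices start
    at 0. *)
Lemma wall_sum_step M a b : (a < b <= M)%N -> (0 < m)%N ->
  wall_sum M.+1 a b = phi M.+2 m (wall_sum M a b).
Proof.
move=> abM m0; have /andP [ab bM] := abM.
(* The intermediate sum is over pairs of a point of rank [M] and the value of c after the
   extension. *)
pose f' (y : (nat -> R) * 'I_(m * M.+1).+1) := (tab M y.1, y.2).
pose Q' (y : (nat -> R) * 'I_(m * M.+1).+1) := walled M a b y.1 /\ (ccount m M y.1 <= y.2)%N.
pose w' (y : (nat -> R) * 'I_(m * M.+1).+1) : pqpoly :=
  pvar ^+ y.2 * qvar ^+ (rcount m M y.1 + m).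
pose g x : (nat -> R) * 'I_(m * M.+1).+1 := (x, inord (ccount m M.+1 x)).
have inK x : (inord (ccount m M.+1 x) : 'I_(m * M.+1).+1) = ccount m M.+1 x :> nat.
  by rewrite inordK // ltnS ccount_le.
have wS x : walled M.+1 a b x -> walled M a b x.
  by move=> [gx wx]; split=> //; exact: genericS gx.
have w'P : class_invariant f' Q' w'.
  by move=> [x c] [z d] _ _ [/tabP s ->]; rewrite /w' /= (rcount_same s).
transitivity (class_sum f' Q' w').
  apply: (@class_sum_reindex _ _ _ _ _ _ _ _ _ _ _ g) => //.
  - move=> x wx; split; first exact: wS.
    by rewrite /= inK ccount_mono //; case: wx.
  - by move=> x wx; rewrite /weight /w' /= inK (wall_rcount abM wx).
  - move=> x z [gx wx] [gz wz]; rewrite /f' /=; split=> [/tabP s|[/tabP s c]].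
      rewrite (ccount_same s); congr (_, _); apply/tabP.
      exact: (same_sideW (leqnn m) (leqnSn M) s).
    apply/tabP => i j k /andP [ij]; rewrite leq_eqVlt => /orP [/eqP jM|jM] km.
      subst j; apply: (column_unique (genericS (leqnSn M) gx) (genericS (leqnSn M) gz)) => //.
        exact: (same_sideW (leq_pred m) (leqnn M) s).
      by have := congr1 val c; rewrite /= !inK.
    by apply: s => //; rewrite ij.
  - move=> [x c] [[gx wx] /= cx]; have [|y [gy yc]] := @extend_count R m M x c gx.
      by rewrite cx -ltnS ltn_ord.
    have E i : (i <= M)%N -> update x M.+1 y i = x i by move=> ?; rewrite updateE.
    exists (update x M.+1 y).
      by split=> //; apply: has_wall_ext wx => // i ib; rewrite E // (leq_trans ib).
    rewrite /f' /=; congr (_, _); first by apply/tabP; exact: same_side_ext.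
    by apply: val_inj; rewrite /= inK ccount_update yc.
rewrite /wall_sum /class_sum phi_sum.
rewrite (eq_bigr (fun tc => class_val f' Q' w' (tc.1, tc.2))); last by case.
rewrite -(pair_bigA _ (fun t c => class_val f' Q' w' (t, c))) /=.
apply: eq_bigr => t _.
have [[x [Qx <-]]|none] := pselect (exists x, walled M a b x /\ tab M x = t); last first.
  rewrite (class_val_out _ none) phi0 big1 // => c _; apply: class_val_out.
  by move=> [[x d] [[Qx _]] [xt _]]; apply: none; exists x.
rewrite class_valE //; last exact: weight_invariant.
rewrite phi_monomial; last first.
  rewrite (wall_ccount abM Qx) /= (leq_trans (ccount_le _ _ _)) //.
  by rewrite leq_mul2l leqnSn orbT.
rewrite [RHS]big_mkcond; apply: eq_bigr => c _; case: ifP => cx.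
  by rewrite -[(tab M x, c)]/(f' (x, c)) class_valE.
apply: class_val_out => [[[z d] [[/= Qz zd] [/tabP s dc]]]].
by move: cx; rewrite -dc -(ccount_same s) zd.
Qed.

Lemma phi_comp_wall_sum M a b : (a < b <= M)%N -> (0 < m)%N ->
  phi_comp m b.+2 M.+1 (wall_sum b a b) = wall_sum M a b.
Proof.
move=> /andP [ab bM] m0; move: bM => /subnK <-; elim: (M - b)%N => [|d IH].
  by rewrite phi_comp_nil.
by rewrite addSn phi_comp_recr ?IH ?wall_sum_step ?ab //; lia.
Qed.

Definition reflect_pt M x : nat -> R := fun i => - x (M - i)%N.

Lemma reflect_ptK M x i : (i <= M)%N -> reflect_pt M (reflect_pt M x) i = x i.
Proof. by move=> iM; rewrite /reflect_pt opprK subKn. Qed.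

Lemma reflect_lt M x i j (k : nat) :
  (reflect_pt M x j + k%:R < reflect_pt M x i) = (x (M - i)%N + k%:R < x (M - j)%N).
Proof. by rewrite /reflect_pt; apply/idP/idP; lra. Qed.

Lemma reflect_generic M x : generic m M x -> generic m M (reflect_pt M x).
Proof.
move=> gx i j /andP [ij jM]; have [|lt ne] := gx (M - j)%N (M - i)%N.
  by lia.
split=> [|k km]; first by rewrite /reflect_pt; lra.
by have := ne k km; rewrite /reflect_pt; apply: contraNN => /eqP E; apply/eqP; lra.
Qed.

Lemma reflect_same M x z : same_side m M x z ->
  same_side m M (reflect_pt M x) (reflect_pt M z).
Proof. by move=> s i j k ij km; rewrite !reflect_lt; apply: s => //; lia. Qed.

Lemma reflect_wall M a b x : (a < b <= M)%N -> has_wall a b x ->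
  has_wall (M - b) (M - a) (reflect_pt M x).
Proof.
move=> abM [w1 w2]; split; first by rewrite reflect_lt !subKn //; lia.
move=> t k tab_ km; rewrite !reflect_lt.
rewrite !subKn; [|lia|lia] => l1; apply/negP => l2.
have lt : (a < M - t < b)%N by lia.
(* Reflection exchanges the two inequalities at the intermediate index, which turns the level [k]
   into [m - k]. *)
by have := w2 _ (m - k)%N lt (leq_subr _ _) l2; rewrite subKn // l1.
Qed.

Lemma reflect_ccount M x : ccount m M (reflect_pt M x) = rcount m M x.
Proof.
rewrite ccountE rcountE (reindex_inj rev_ord_inj) /=; apply: eq_bigr => i _.
apply: eq_bigr => k _; rewrite reflect_lt subnn.
by rewrite (_ : (M - (M - i.+1))%N = i.+1) // subKn.
Qed.

Lemma reflect_rcount M x : rcount m M (reflect_pt M x) = ccount m M x.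
Proof.
rewrite ccountE rcountE (reindex_inj rev_ord_inj) /=; apply: eq_bigr => i _.
apply: eq_bigr => k _; rewrite reflect_lt subn0.
by rewrite -subSn // subSS subKn // ltnW.
Qed.

Lemma rho_class_sum X (T : finType) (f : X -> T) Q w :
  rho (class_sum f Q w) = class_sum f Q (rho \o w).
Proof.
rewrite /rho /class_sum raddf_sum; apply: eq_bigr => t _; rewrite /class_val.
by case: pselect => // _; rewrite raddf0.
Qed.

Lemma wall_sum_reflect M a b : (a < b <= M)%N -> (0 < m)%N ->
  wall_sum M a b = rho (wall_sum M (M - b) (M - a)).
Proof.
move=> abM m0; rewrite /wall_sum rho_class_sum.
have KK x : same_side m M (reflect_pt M (reflect_pt M x)) x.
  by apply: same_side_ext => i iM; rewrite reflect_ptK.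
apply: (@class_sum_reindex _ _ _ _ _ _ _ _ _ _ _ (reflect_pt M)).
- by move=> x z Qx Qz /(weight_invariant Qx Qz) /= ->.
- by move=> x [gx wx]; split; [exact: reflect_generic|exact: reflect_wall].
- by move=> x _; rewrite /weight /= rho_monomial reflect_ccount reflect_rcount.
- move=> x z _ _; split=> /tabP s; apply/tabP; first exact: reflect_same.
  have := reflect_same s; move=> s2; apply: same_side_trans (KK z).
  exact: same_side_trans (same_side_sym (KK x)) s2.
- move=> y [gy wy]; exists (reflect_pt M y); last by apply/tabP.
  split; first exact: reflect_generic.
  have lt : (M - b < M - a <= M)%N by lia.
  by have := reflect_wall lt wy; rewrite !subKn //; lia.
Qed.

End Recursions.

(** * The highest root *)

Section Ranks.
Variable T : nat.

Lemma perm_rankE (s : {perm 'I_T}) (i : 'I_T) :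
  s i = #|[set j | (s j < s i)%N]%SET| :> nat.
Proof.
have -> : [set j | (s j < s i)%N]%SET = (s @^-1: [set k : 'I_T | (k < s i)%N])%SET.
  by apply/setP => j; rewrite !inE.
rewrite card_preimset; last exact: perm_inj.
rewrite -sum1dep_card -(big_ord_widen _ (fun=> 1%N)); last exact: ltnW.
by rewrite sum_nat_const card_ord muln1.
Qed.

Lemma perm_order_inj (s t : {perm 'I_T}) :
  (forall i j, (s i < s j)%N = (t i < t j)%N) -> s = t.
Proof.
move=> st; apply/permP => i; apply: val_inj; rewrite /= [LHS]perm_rankE [RHS]perm_rankE.
by congr #|pred_of_set _|; apply/setP => j; rewrite !inE st.
Qed.

(** The permutation sends an index to the number of indices with smaller value. *)
Lemma rank_perm (R : realDomainType) (v : 'I_T -> R) : injective v ->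
  exists s : {perm 'I_T}, forall i j, (s i < s j)%N = (v i < v j).
Proof.
move=> vinj; pose L i := [set j | v j < v i]%SET.
have Lproper i j : v i < v j -> (L i \proper L j)%SET.
  move=> ij; apply/properP; split.
    by apply/fintype.subsetP => k; rewrite !inE => /lt_trans; apply.
  by exists i; rewrite !inE ?ltxx.
have Llt i : (#|L i| < T)%N.
  rewrite -[X in (_ < X)%N](card_ord T) -cardsT; apply: proper_card.
  by apply/properP; split; [exact: finset.subsetT|exists i; rewrite !inE ?ltxx].
have Lmono i j : (#|L i| < #|L j|)%N = (v i < v j).
  have [ij|ji|ij] := ltgtP (v i) (v j); first by rewrite proper_card ?Lproper.
    by rewrite ltnNge ltnW // proper_card ?Lproper.
  by rewrite (vinj _ _ ij) ltnn.
have rinj : injective (fun i => Ordinal (Llt i)).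
  move=> i j [] E; apply: vinj; have := Lmono i j; have := Lmono j i.
  by rewrite E ltnn; case: ltgtP.
by exists (perm rinj) => i j; rewrite !permE /= Lmono.
Qed.

End Ranks.

Lemma frac_lt (R : realFieldType) (A B : nat) (f f' g g' : R) :
  0 <= f < 1 -> 0 <= f' < 1 -> 0 <= g < 1 -> 0 <= g' < 1 -> (f < f') = (g < g') ->
  (A%:R + f < B%:R + f') = (A%:R + g < B%:R + g').
Proof.
move=> f01 f'01 g01 g'01 E; case: (ltngtP A B) => [lt|lt|->].
- have : A.+1%:R <= B%:R :> R by rewrite ler_nat.
  by rewrite -natr1 => ?; transitivity true; [|symmetry]; lra.
- have : B.+1%:R <= A%:R :> R by rewrite ler_nat.
  by rewrite -natr1 => ?; transitivity false; [|symmetry]; apply/negP; lra.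
- by rewrite !ltrD2l.
Qed.

Lemma frac_neq (R : realFieldType) (A B : nat) (f f' : R) :
  0 <= f < 1 -> 0 <= f' < 1 -> f != f' -> A%:R + f != B%:R + f'.
Proof.
move=> f01 f'01 ff'; case: (ltngtP A B) => [lt|lt|->].
- have : A.+1%:R <= B%:R :> R by rewrite ler_nat.
  by rewrite -natr1 => ?; rewrite lt_eqF //; lra.
- have : B.+1%:R <= A%:R :> R by rewrite ler_nat.
  by rewrite -natr1 => ?; rewrite gt_eqF //; lra.
- by rewrite (inj_eq (addrI _)).
Qed.

Lemma sum_nat_lt (m c : nat) : (c <= m)%N -> (\sum_(k < m) (k < c) = c)%N.
Proof.
move=> cm; suff -> : (\sum_(k < m) (k < c) = minn m c)%N by apply/minn_idPr.
elim: m {cm} => [|m IH]; first by rewrite big_ord0 min0n.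
by rewrite big_ord_recr /= IH; case: ltnP; lia.
Qed.

(** * Words over [m] letters and the regions whose wall is given by the highest root *)

Section Words.
Variables (R : realType) (m T : nat).
Hypothesis m_gt0 : (0 < m)%N.
Implicit Types (w : {ffun 'I_T -> 'I_m}).

Let unit_step : R := T.+1%:R^-1.
Let unit_step_gt0 : 0 < unit_step. Proof. by rewrite invr_gt0 ltr0n. Qed.

(** Evenly spaced fractional parts strictly between 0 and 1. The least one is a full step, which
    leaves room for a value at half a step. *)
Definition slot (s : 'I_T) : R := s.+1%:R / T.+1%:R.

Lemma slot_lt s t : (slot s < slot t) = (s < t)%N.
Proof. by rewrite /slot ltr_pM2r ?invr_gt0 ?ltr0n // ltr_nat ltnS. Qed.

Lemma slot_ge s : T.+1%:R^-1 <= slot s.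
Proof. by rewrite /slot ler_peMl ?ler1n // invr_ge0 ler0n. Qed.

Lemma slot_lt1 s : slot s < 1.
Proof. by rewrite /slot ltr_pdivrMr ?ltr0n // mul1r ltr_nat ltnS ltn_ord. Qed.

Lemma slot_01 s : 0 <= slot s < 1.
Proof.
by rewrite slot_lt1 andbT (le_trans _ (slot_ge s)) // invr_ge0 ler0n.
Qed.

Lemma slot_inj : injective slot.
Proof.
by move=> s t E; case: (ltngtP s t) => [||/val_inj //]; rewrite -slot_lt E ltxx.
Qed.

(** The letter is the integral part of a distance from x_0; the position in the word is the rank of
    its fractional part. *)
Definition depth w (s : 'I_T) : R := (w s)%:R + slot s.

Lemma depth_inj w : injective (depth w).
Proof.
move=> s t E; apply: contraPeq E => st; apply/eqP.
by apply: frac_neq; rewrite ?slot_01 // (inj_eq slot_inj).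
Qed.

Lemma sort_word_ex w :
  exists s : {perm 'I_T}, forall i j : 'I_T, (i < j)%N = (depth w (s i) < depth w (s j)).
Proof.
have [s sE] := rank_perm (@depth_inj w).
by exists (s^-1)%g => i j; rewrite -sE !permKV.
Qed.

Definition sort_word w : {perm 'I_T} := sval (cid (sort_word_ex w)).

Lemma sort_wordP w (i j : 'I_T) :
  (i < j)%N = (depth w (sort_word w i) < depth w (sort_word w j)).
Proof. by rewrite /sort_word; case: cid. Qed.

Lemma sort_word_unique w (s : {perm 'I_T}) :
  (forall i j : 'I_T, (i < j)%N -> depth w (s i) < depth w (s j)) -> s = sort_word w.
Proof.
move=> sE; apply: invg_inj; apply: perm_order_inj => i j.
have mono (a b : 'I_T) : (a < b)%N = (depth w (s a) < depth w (s b)).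
  case: (ltngtP a b) => [ab|ba|/val_inj ->]; last by rewrite ltxx.
    by rewrite sE.
  by apply/esym/negbTE; rewrite -leNgt ltW // sE.
by rewrite [LHS]mono [RHS](sort_wordP w) !permKV.
Qed.

(** The interior coordinates are placed by increasing depth. The last one lies beyond distance [m]
    by half a step, less than any fractional part in use, so no shift falls between it and x_0 -
    m. *)
Definition word_pt w (i : nat) : R :=
  if i is i'.+1 then
    if insub i' is Some s then - depth w (sort_word w s)
    else - (m%:R + unit_step / 2)
  else 0.

Lemma word_ptS w (s : 'I_T) : word_pt w s.+1 = - depth w (sort_word w s).
Proof. by rewrite /word_pt valK. Qed.

Lemma word_pt_last w : word_pt w T.+1 = - (m%:R + unit_step / 2).
Proof. by rewrite /word_pt insubF // ltnn. Qed.

Lemma index_cases (i : nat) : (i <= T.+1)%N ->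
  [\/ i = 0%N, exists s : 'I_T, i = s.+1 | i = T.+1].
Proof.
case: i => [|i]; first by constructor 1.
rewrite ltnS leq_eqVlt => /orP [/eqP ->|iT]; first by constructor 3.
by constructor 2; exists (Ordinal iT).
Qed.

Lemma unit_step_half : 0 <= unit_step / 2 < 1.
Proof.
have : unit_step <= 1 by rewrite /unit_step invf_le1 ?ltr0n // ler1n.
by move: unit_step_gt0; lra.
Qed.

Lemma nat_addr_neq (A : nat) (f : R) (k : nat) : 0 <= f < 1 -> f != 0 ->
  A%:R + f != k%:R.
Proof. by move=> f01 f0; rewrite -[k%:R]addr0 frac_neq ?lexx ?ltr01. Qed.

Lemma slot_neq0 s : slot s != 0.
Proof. by rewrite gt_eqF // (lt_le_trans _ (slot_ge s)) // invr_gt0 ltr0n. Qed.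

Lemma word_letter w s (k : nat) : (k%:R < depth w s) = (k <= w s)%N.
Proof.
rewrite /depth; have s1 := slot_lt1 s; have := slot_ge s; rewrite -/unit_step => s0.
have u0 := unit_step_gt0; apply/idP/idP => h.
  rewrite leqNgt; apply/negP => h'; have : (w s).+1%:R <= k%:R :> R by rewrite ler_nat.
  by rewrite -natr1; lra.
have : k%:R <= (w s)%:R :> R by rewrite ler_nat.
by lra.
Qed.

(** Only integral parts matter, because every slot lies strictly between half a step and 1. *)
Lemma word_last_lt w s (k : nat) :
  (depth w s + k%:R < m%:R + unit_step / 2) = (k <= m.-1 - w s)%N.
Proof.
have -> : depth w s + k%:R = (w s + k)%:R + slot s by rewrite /depth natrD; lra.
have s1 := slot_lt1 s; have := slot_ge s; rewrite -/unit_step => s0.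
have u0 := unit_step_gt0; have ws := ltn_ord (w s); apply/idP/idP => h.
  suff : (w s + k < m)%N by lia.
  rewrite ltnNge; apply/negP => h'; have : m%:R <= (w s + k)%:R :> R by rewrite ler_nat.
  by lra.
have : (w s + k).+1%:R <= m%:R :> R by rewrite ler_nat; lia.
by rewrite -natr1; lra.
Qed.

Lemma depth_lt w s : depth w s < m%:R.
Proof.
have : (w s).+1%:R <= m%:R :> R by rewrite ler_nat ltn_ord.
by rewrite /depth -natr1; move: (slot_lt1 s); lra.
Qed.

Lemma depth_gt0 w s : 0 < depth w s.
Proof. by have := word_letter w s 0; rewrite leq0n. Qed.

Lemma word_pt_generic w : generic m T.+1 (word_pt w).
Proof.
move=> i j /andP [ij jT].
have uh := unit_step_half; have u0 := unit_step_gt0.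
have mk (x y : R) : y < x -> (forall k : nat, - y != - x + k%:R) ->
    y < x /\ forall k, (k <= m)%N -> x != y + k%:R.
  move=> yx ne; split=> // k _; apply: contraNneq (ne k) => ->.
  by apply/eqP; lra.
case: (index_cases jT) ij => [->//|[t ->]|->] {j jT}; last first.
  move=> iT; have := index_cases (ltnW iT); case=> [->|[s E]|E]; last by lia.
    rewrite word_pt_last; apply: mk => [|k].
      by have : 0 <= m%:R :> R by []; rewrite /word_pt; lra.
    by rewrite /= oppr0 add0r opprK nat_addr_neq //; lra.
  subst i; rewrite word_pt_last word_ptS; set s' := sort_word w s; apply: mk => [|k].
    by rewrite ltrN2 (lt_trans (depth_lt w s')) //; lra.
  rewrite !opprK /depth addrAC -natrD frac_neq ?slot_01 //.
  by have := slot_ge s'; rewrite -/unit_step => ?; rewrite lt_eqF //; lra.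
case: i => [|i] it.
  rewrite word_ptS /=; apply: mk => [|k]; first by rewrite oppr_lt0 depth_gt0.
  by rewrite oppr0 add0r opprK nat_addr_neq ?slot_01 ?slot_neq0.
have iT : (i < T)%N by apply: leq_trans (ltn_ord t); rewrite ltnW.
rewrite -[i]/(val (Ordinal iT)) in it *; rewrite !word_ptS.
move: (Ordinal iT) it => s st; apply: mk => [|k].
  by rewrite ltrN2 -sort_wordP.
rewrite !opprK /depth addrAC -natrD frac_neq ?slot_01 //.
rewrite (inj_eq slot_inj) (inj_eq perm_inj).
by rewrite -val_eqE /= gtn_eqF.
Qed.

Lemma word_pt_lt0 w (s : 'I_T) (k : nat) :
  (word_pt w s.+1 + k%:R < word_pt w 0) = (k <= w (sort_word w s))%N.
Proof. by rewrite word_ptS /= -word_letter; apply/idP/idP; lra. Qed.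

Lemma word_pt_last_lt w (s : 'I_T) (k : nat) :
  (word_pt w T.+1 + k%:R < word_pt w s.+1) = (k <= m.-1 - w (sort_word w s))%N.
Proof. by rewrite word_ptS word_pt_last -word_last_lt; apply/idP/idP; lra. Qed.

Lemma word_pt_mid_lt w (s t : 'I_T) (k : nat) :
  (word_pt w t.+1 + k%:R < word_pt w s.+1) =
  (depth w (sort_word w s) + k%:R < depth w (sort_word w t)).
Proof. by rewrite !word_ptS; apply/idP/idP; lra. Qed.

Lemma word_pt_end_lt w (k : nat) : (k <= m)%N -> word_pt w T.+1 + k%:R < word_pt w 0.
Proof.
by rewrite -(ler_nat R) => km; rewrite word_pt_last /=; move: unit_step_gt0; lra.
Qed.

Lemma word_pt_wall w : has_wall m 0 T.+1 (word_pt w).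
Proof.
split; first exact: word_pt_end_lt.
move=> t k /andP [t0 tT] km; have [E|[s E]|E] := index_cases (ltnW tT); try lia.
subst t; rewrite word_pt_lt0 word_pt_last_lt => kw.
by have := ltn_ord (w (sort_word w s)); lia.
Qed.

Lemma word_pt_inj w w' :
  same_side m T.+1 (word_pt w) (word_pt w') -> w = w'.
Proof.
move=> ss; have gw := word_pt_generic w; have gw' := word_pt_generic w'.
have h i j k := @same_side0 _ _ _ _ _ _ i j k gw gw' ss.
have letterE s : w (sort_word w s) = w' (sort_word w' s) :> nat.
  have l1 := ltn_ord (w (sort_word w s)); have l2 := ltn_ord (w' (sort_word w' s)).
  have hs k : (k <= m)%N -> (k <= w (sort_word w s))%N = (k <= w' (sort_word w' s))%N.
    by move=> km; rewrite -!word_pt_lt0; apply: h => //; have := ltn_ord s; lia.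
  apply/eqP; rewrite eqn_leq -hs ?leqnn ?(ltnW l1) //=.
  by rewrite hs ?leqnn // ltnW.
(* With the letters known, testing a pair at the level equal to the difference of its letters
   compares exactly the two fractional parts, hence the positions. *)
have mono (i j : 'I_T) : (i < j)%N -> (sort_word w i < sort_word w j)%N =
                            (sort_word w' i < sort_word w' j)%N.
  move=> ij; have lt : (i.+1 < j.+1 <= T.+1)%N by have := ltn_ord j; lia.
  have wij : (w (sort_word w i) <= w (sort_word w j))%N.
    rewrite leqNgt; apply/negP; rewrite -(ler_nat R) -natr1 => l.
    have := sort_wordP w i j; rewrite ij /depth => /esym.
    by have := slot_01 (sort_word w i); have := slot_01 (sort_word w j); lra.
  have := h _ _ (w (sort_word w j) - w (sort_word w i))%N lt.
  rewrite (leq_trans (leq_subr _ _)) ?(ltnW (ltn_ord _)) // => /(_ isT).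
  rewrite !word_pt_mid_lt /depth -!letterE natrB // -!slot_lt => E.
  apply/idP/idP => l; [have : (w (sort_word w i))%:R + slot (sort_word w i) +
    ((w (sort_word w j))%:R - (w (sort_word w i))%:R) <
    (w (sort_word w j))%:R + slot (sort_word w j) by lra |
    have : (w (sort_word w i))%:R + slot (sort_word w' i) +
    ((w (sort_word w j))%:R - (w (sort_word w i))%:R) <
    (w (sort_word w j))%:R + slot (sort_word w' j) by lra]; rewrite ?E -?E; lra.
have sE : sort_word w = sort_word w'.
  apply: perm_order_inj => i j; case: (ltngtP i j) => [ij|ji|/val_inj ->].
  - exact: mono.
  - have := mono _ _ ji.
    case: ltngtP => [||/val_inj/perm_inj E]; last by rewrite E ltnn in ji.
      by move=> _; case: ltngtP.
    move=> _ /esym; case: ltngtP => // /val_inj/perm_inj E.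
    by rewrite E ltnn in ji.
  - by rewrite !ltnn.
apply/ffunP => s; apply: val_inj; have := letterE ((sort_word w)^-1%g s).
by rewrite -sE !permKV.
Qed.

Lemma word_pt_surj (x : nat -> R) : walled m T.+1 0 T.+1 x ->
  exists w, same_side m T.+1 (word_pt w) x.
Proof.
move=> [gx [wx wall]].
have x0 (i : 'I_T) : (0 < i.+1 <= T.+1)%N by have := ltn_ord i; lia.
have xT (i : 'I_T) : (i.+1 < T.+1 <= T.+1)%N by have := ltn_ord i; lia.
pose a (i : 'I_T) := Num.truncn (x 0%N - x i.+1).
have aP i : (a i)%:R <= x 0%N - x i.+1 < (a i).+1%:R.
  by apply: truncn_itv; have [] := gx _ _ (x0 i); lra.
(* A coordinate farther than [m] from x_0 would, at level [m], violate the wall condition together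
   with x_(T+1) < x_(i+1). *)
have am i : (a i < m)%N.
  rewrite ltnNge; apply/negP; rewrite -(ler_nat R) => ma.
  have [_ /(_ m (leqnn m)) /eqP ne] := gx _ _ (x0 i).
  have := wall i.+1 m; rewrite leqnn !ltnS ltn_ord => /(_ isT isT).
  rewrite subnn addr0 (proj1 (gx _ _ (xT i))) => w'; suff : false by [].
  apply: w'; have ai := aP i; rewrite lt_neqAle; apply/andP; split; last by lra.
  by apply/eqP => E; apply: ne; lra.
pose f (i : 'I_T) := x 0%N - x i.+1 - (a i)%:R.
have f0 i : 0 < f i.
  have [_ /(_ (a i) (ltnW (am i))) ne] := gx _ _ (x0 i).
  rewrite lt_neqAle /f; apply/andP; split; last by have := aP i; lra.
  by apply: contraNneq ne => E; apply/eqP; lra.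
have f01 i : 0 <= f i < 1.
  by rewrite ltW //=; have := aP i; rewrite /f -natr1; lra.
(* Equal fractional parts would put a difference of coordinates at an integral level below [m],
   which genericity forbids. *)
have finj : injective f.
  suff W (i j : 'I_T) : (i < j)%N -> f i != f j.
    by move=> i j; case: (ltngtP i j) => [/W/eqP//|/W/eqP ne E|/val_inj //]; case: ne.
  move=> ij; have lt : (i.+1 < j.+1 <= T.+1)%N by have := ltn_ord j; lia.
  have [l ne] := gx _ _ lt; apply/eqP; rewrite /f => E.
  have aij : (a i < a j)%N by rewrite -(ltr_nat R); lra.
  have := ne (a j - a i)%N; rewrite natrB; last exact: ltnW.
  rewrite (leq_trans (leq_subr _ _)) ?(ltnW (am _)) // => /(_ isT) /eqP; apply.
  by lra.
have [s sE] := rank_perm finj.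
(* The letter at position [t] belongs to the coordinate whose fractional part has rank [t]. *)
pose w : {ffun 'I_T -> 'I_m} := [ffun t => Ordinal (am (s^-1%g t))].
have wE i : w (s i) = a i :> nat by rewrite ffunE /= permK.
have key (i j : 'I_T) (k : nat) : (x j.+1 + k%:R < x i.+1) =
                         (depth w (s i) + k%:R < depth w (s j)).
  have -> : (x j.+1 + k%:R < x i.+1) = ((a i + k)%:R + f i < (a j)%:R + f j).
    by rewrite /f natrD; apply/idP/idP; lra.
  rewrite (frac_lt _ _ (f01 i) (f01 j) (slot_01 (s i)) (slot_01 (s j))).
    by rewrite /depth !wE natrD; apply/idP/idP; lra.
  by rewrite slot_lt sE.
have swE : s = sort_word w.
  apply: sort_word_unique => i j ij; have := key i j 0%N; rewrite !addr0 => <-.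
  by have [|] := gx i.+1 j.+1; first by have := ltn_ord j; lia.
exists w => i j k /andP [ij jT] /andP [k0 km].
have [E|[t E]|E] := index_cases jT; first by lia.
  subst j; case: i ij => [|i] ij; last first.
    have iT : (i < T)%N by apply: leq_trans (ltn_ord t); rewrite ltnW.
    rewrite -[i]/(val (Ordinal iT)); move: (Ordinal iT) => i'.
    by rewrite word_pt_mid_lt -swE -key.
  rewrite word_pt_lt0 -swE wE.
  apply/idP/idP => h.
    have : k%:R <= (a t)%:R :> R by rewrite ler_nat.
    by have := f0 t; rewrite /f; lra.
  rewrite leqNgt; apply/negP; rewrite -(ler_nat R) => h'.
  by have := aP t; lra.
subst j; have kmR : k%:R <= m%:R :> R by rewrite ler_nat.
have [E|[t E]|E] := index_cases (ltnW ij); last by lia.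
  subst i; rewrite word_pt_end_lt //; apply/esym; lra.
subst i; rewrite word_pt_last_lt -swE wE.
apply/idP/idP => h.
  have : (k + a t).+1%:R <= m%:R :> R by rewrite ler_nat; have := am t; lia.
  by rewrite -natr1 natrD; have := aP t; rewrite -natr1; lra.
rewrite leqNgt; apply/negP => h'.
(* At level [a t] the wall condition bounds the distance from x_(t+1) to the last coordinate by
   [m - a t]. *)
have := wall t.+1 (a t); rewrite ltn0Sn ltnS ltn_ord ltnW // => /(_ isT isT) W.
have {}W : ~~ (x T.+1 + (m - a t)%:R < x t.+1) by apply: W; have := f0 t; rewrite /f; lra.
have : (m - a t)%:R <= k%:R :> R by rewrite ler_nat; have := am t; lia.
by move: W; rewrite -leNgt; lra.
Qed.

Lemma word_rcount w : rcount m T.+1 (word_pt w) = (m + \sum_s w s)%N.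
Proof.
rewrite rcountE big_ord_recr /= addnC; congr (_ + _)%N.
  rewrite -[RHS](sum_nat_lt (leqnn m)); apply: eq_bigr => k _.
  by rewrite ltn_ord word_pt_end_lt.
rewrite [RHS](reindex_inj (@perm_inj _ (sort_word w))); apply: eq_bigr => s _ /=.
rewrite -[RHS](@sum_nat_lt m); last exact: ltnW.
by apply: eq_bigr => k _; rewrite word_pt_lt0.
Qed.

Lemma word_ccount w : ccount m T.+1 (word_pt w) = (m + \sum_s (m.-1 - w s))%N.
Proof.
rewrite ccountE big_ord_recl /=; congr (_ + _)%N.
  rewrite -[RHS](sum_nat_lt (leqnn m)); apply: eq_bigr => k _.
  by rewrite ltn_ord word_pt_end_lt.
rewrite [RHS](reindex_inj (@perm_inj _ (sort_word w))); apply: eq_bigr => s _ /=.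
rewrite -[RHS](@sum_nat_lt m); last by lia.
by apply: eq_bigr => k _; rewrite word_pt_last_lt.
Qed.

(** A letter [j] contributes [j] to r and [m - 1 - j] to c, and the pair of end coordinates
    contributes [m] to each. Expanding the power of the bracket then gives one term per word. *)
Lemma wall_sum_highest :
  wall_sum R m T.+1 0 T.+1 = pvar ^+ m * qvar ^+ m * bracket_pq m ^+ T.
Proof.
transitivity (class_sum (T := {ffun 'I_T -> 'I_m}) id (fun=> True)
                (fun w => weight m T.+1 (word_pt w))).
  apply/esym; apply: (class_sum_reindex (g := word_pt)) => //.
  - exact: weight_invariant.
  - by move=> w _; split; [exact: word_pt_generic|exact: word_pt_wall].
  - move=> w w' _ _; split=> [->//|/tabP]; exact: word_pt_inj.
  - by move=> x /word_pt_surj [w ss]; exists w => //; apply/tabP.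
have -> : bracket_pq m = \sum_(j < m) pvar ^+ (m.-1 - j) * qvar ^+ j.
  rewrite /bracket_pq (reindex_inj rev_ord_inj); apply: eq_bigr => j _ /=.
  have jm := ltn_ord j; congr (_ ^+ _ * _ ^+ _); lia.
rewrite -[in RHS](card_ord T) -prodr_const bigA_distr_bigA mulr_sumr /class_sum.
apply: eq_bigr => w _; rewrite -[w in LHS]/(id w) class_valE //; last by move=> ? ? _ _ ->.
rewrite /weight word_rcount word_ccount !exprD big_split /= !expr_sum.
by rewrite mulrACA.
Qed.

End Words.

(** * Crossing a wall *)

Section Crossing.
Variables (R : realType) (m : nat).
Hypothesis m_gt0 : (0 < m)%N.
Implicit Types (x y z : nat -> R).

(* [z] lies on the same sides as [x], except that it is across [x_a - x_b = m]. *)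
Definition across a b M x z := z a < z b + m%:R /\
  forall i j k, (i < j <= M)%N -> (0 < k <= m)%N -> (i, j, k) != (a, b, m) ->
    (x j + k%:R < x i) = (z j + k%:R < z i).

(** When the wall involves the last coordinate, it suffices to raise that coordinate to just above
    x_a - m: the wall condition says that no other inequality changes on the way. *)
Lemma across_base a b x : (a <= b)%N -> generic m b.+1 x -> has_wall m a b.+1 x ->
  exists z, generic m b.+1 z /\ across a b.+1 b.+1 x z.
Proof.
move=> ab gx [w1 w2].
(* The values are negated to obtain a gap above x_a - m from [gap_below]. Level 0 is included so
   that the raised coordinate stays below the others. *)
pose v (p : 'I_b.+1 * 'I_m.+1) := - (x p.1 - p.2%:R).
have [y0 y0e gap] := gap_below v (m%:R - x a); pose y := - y0.
have ey : x a - m%:R < y by rewrite /y; lra.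
have up i k : (i <= b)%N -> (k <= m)%N -> x a - m%:R < x i - k%:R -> y < x i - k%:R.
  move=> ib km h; have := gap (Ordinal (ib : i < b.+1)%N, Ordinal (km : k < m.+1)%N).
  rewrite /v /y /= => g; suff : - (x i - k%:R) < y0 by lra.
  by apply: g; lra.
have xab i : (i <= b)%N -> x a < x i + m%:R.
  move=> ib; have [ia|ai] := leqP i a.
    have := @generic_le _ m _ x i a gx; rewrite ia (leq_trans ab) // => /(_ isT).
    have : 0 < m%:R :> R by rewrite ltr0n.
    by lra.
  have lt : (a < i <= b.+1)%N by rewrite ai (leq_trans ib).
  rewrite (generic_lt gx lt) //; apply/negP => h.
  have := w2 i m; rewrite ai ltnS ib leqnn subnn addr0 => /(_ isT isT h).
  by have [|->] := gx i b.+1; rewrite // ltnS ib leqnn.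
have eqE i k : (i <= b)%N -> (k <= m)%N -> x i - k%:R != y.
  move=> ib km; apply/eqP => E; have := up i k ib km; rewrite E ltxx => /(_ ey).
  by [].
exists (update x b.+1 y); split.
  apply: update_generic; first exact: genericS gx.
    by have := up b 0%N; rewrite !subr0 => -> //; have := xab b (leqnn b); lra.
  by move=> [[i ib] [k km]]; apply: eqE.
split=> [|i j k /andP [ij jb] /andP [k0 km] ne].
  by rewrite /update eqxx ltn_eqF //; lra.
rewrite /update (ltn_eqF (leq_trans ij jb)); case: eqP => [E|/eqP jb']; last by [].
subst j; have ib : (i <= b)%N by [].
apply/idP/idP => h; last by lra.
suff : x a - m%:R < x i - k%:R by move=> /(up i k ib km); lra.
have kR : k%:R <= m%:R :> R by rewrite ler_nat.
(* Before [a], monotonicity suffices; after [a], the wall condition at level [m - k] applies; at [a]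
   itself, the excluded triple forces [k < m]. *)
case: (ltngtP i a) => [ia|ai|ia].
- by have [|] := gx i a; [rewrite ia (leq_trans ab)|lra].
- have lt : (a < i <= b.+1)%N by rewrite ai (leq_trans ib).
  have := w2 i (m - k)%N; rewrite ai ltnS ib leq_subr subKn // h => /(_ isT isT) W.
  have : ~~ (x i + (m - k)%:R < x a) by apply/negP => /W.
  by rewrite -(generic_lt gx lt) ?leq_subr // natrB //; lra.
- subst i; have : k%:R < m%:R :> R.
    rewrite ltr_nat ltn_neqAle km andbT; apply: contraNneq ne => ->.
    by rewrite eqxx.
  by lra.
Qed.

(** The later coordinates are added back one at a time. Crossing changes a comparison at level [m]
    only, and the order of the shifts uses levels up to [m - 1], so [extend_same] applies. *)
Lemma across_ex a b M x : (a < b <= M)%N -> generic m M x -> has_wall m a b x ->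
  exists z, generic m M z /\ across a b M x z.
Proof.
move=> /andP [ab bM]; move: bM => /subnK <-; elim: (M - b)%N => [|d IH].
  by case: b ab => // b ab; rewrite add0n => gx wx; apply: across_base.
rewrite addSn; set N := (d + b)%N => gx wx.
have [z [gz [zab za]]] := IH (genericS (leqnSn _) gx) wx.
have [||y [gy ye]] := extend_same gx gz.
- move=> i j k ij /andP [k0 km]; apply: za => //; first by lia.
  by apply/eqP => - [_ _ E]; lia.
- move=> i k iN km; have [[-> Nb ->]|ne] := (i, N, k) =P (a, b, m).
    by rewrite Nb; lra.
  by rewrite za // ?iN ?leqnn //; apply/eqP.
exists (update z N.+1 y); split=> //.
have bN : (b < N.+1)%N by rewrite ltnS leq_addl.
split=> [|i j k /andP [ij jN] km ne]; first by rewrite !updateE // (ltn_trans ab).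
rewrite [update _ _ _ i]updateE; last exact: leq_trans jN.
have [jE|jE] := eqVneq j N.+1.
  by rewrite jE /update eqxx ye // -ltnS -jE.
have jN' : (j < N.+1)%N by rewrite ltn_neqAle jE.
by rewrite updateE // za // ij.
Qed.

(** This describes the relative interior of the facet: all inequalities of the region stay strict
    except that of the wall. *)
Definition on_wall a b M x y := y a = y b + m%:R /\
  forall i j k, (i < j <= M)%N -> (k <= m)%N -> (i, j, k) != (a, b, m) ->
    if x j + k%:R < x i then y j + k%:R < y i else y i < y j + k%:R.

Lemma on_wall_ex a b M x : (a < b <= M)%N -> generic m M x -> has_wall m a b x ->
  exists y, on_wall a b M x y.
Proof.
(* Take the point where the segment from [x] to a point across the wall meets it. *)
move=> abM gx wx; have [z [gz [zab za]]] := across_ex abM gx wx.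
have xab := proj1 wx.
pose p := x a - x b - m%:R; pose q := z b + m%:R - z a.
have p0 : 0 < p by rewrite /p; lra.
have q0 : 0 < q by rewrite /q; lra.
pose s := p / (p + q); pose r := q / (p + q).
have s0 : 0 < s by rewrite divr_gt0 // addr_gt0.
have r0 : 0 < r by rewrite divr_gt0 // addr_gt0.
have rs : r = 1 - s by rewrite /r /s; field; lra.
have spq : s * q = r * p by rewrite /r /s; field; lra.
exists (fun i => r * x i + s * z i); split.
  by move: spq; rewrite /p /q rs; nra.
move=> i j k ij km ne.
have -> : r * x j + s * z j + k%:R = r * (x j + k%:R) + s * (z j + k%:R).
  by rewrite rs; ring.
have E : (x j + k%:R < x i) = (z j + k%:R < z i).
  case: k km ne => [|k] km ne; last exact: za.
  by rewrite !addr0 (proj1 (gx _ _ ij)) (proj1 (gz _ _ ij)).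
case: ifP => h.
  by apply: ltrD; rewrite ltr_pM2l // -E.
by apply: ltrD; rewrite ltr_pM2l // (generic_lt _ ij km) // -?E h.
Qed.

End Crossing.

Lemma small_eps (R : realFieldType) (I : finType) (P : pred I) (d e : I -> R) :
  (forall i, P i -> 0 < d i) -> exists2 eps, 0 < eps & forall i, P i -> 0 < d i + eps * e i.
Proof.
move=> d0; pose c i := d i / (1 + `|e i|).
have c0 i : P i -> 0 < c i by move=> /d0 ?; rewrite divr_gt0 // ltr_pwDl.
pose r := \big[Num.min/1]_(i | P i) c i.
have r0 : 0 < r by rewrite /r; elim/big_ind: _ => // a b ? ?; rewrite lt_min; apply/andP.
exists (r / 2) => [|i Pi]; first by rewrite divr_gt0.
have rc : r <= c i by rewrite /r (bigD1 i) //= ge_min lexx.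
have a0 : 0 <= `|e i| by [].
have : r * (1 + `|e i|) <= d i by rewrite -ler_pdivlMr // ltr_pwDl.
have : - `|e i| <= e i by rewrite lerNnormlW.
by have := d0 i Pi; nra.
Qed.

(** * Regions of the arrangement *)

Section Regions.
Variables (R : realType) (m M : nat).
Implicit Types (v w : 'rV[R]_M.+1) (x : nat -> R).

Definition coords v : nat -> R := fun i => v 0 (inord i).

(** Subtracting the mean gives a point of [Vspace] with the same differences of coordinates. *)
Definition row_of x : 'rV[R]_M.+1 :=
  \row_l (x l - (\sum_(i < M.+1) x i) / M.+1%:R).

Lemma Vspace_row_of x : Vspace M.+1 (row_of x).
Proof.
rewrite /Vspace /=; under eq_bigr do rewrite mxE.
by rewrite sumrB sumr_const card_ord -[X in _ - X]mulr_natr mulfVK ?subrr.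
Qed.

Lemma coords_row_of x i : (i <= M)%N ->
  coords (row_of x) i = x i - (\sum_(i < M.+1) x i) / M.+1%:R.
Proof. by move=> iM; rewrite /coords mxE inordK. Qed.

Lemma coords_comb (a b : R) v w i :
  coords (a *: v + b *: w) i = a * coords v i + b * coords w i.
Proof. by rewrite /coords !mxE. Qed.

Lemma Vspace_comb (a b : R) v w :
  Vspace M.+1 v -> Vspace M.+1 w -> Vspace M.+1 (a *: v + b *: w).
Proof.
rewrite /Vspace /= => v0 w0; under eq_bigr do rewrite !mxE.
by rewrite big_split /= -!mulr_sumr v0 w0 !mulr0 addr0.
Qed.

Lemma inner_root v i j : (i <= M)%N -> (j <= M)%N ->
  inner v (shi_root M.+1 i.+1 j) = coords v i - coords v j.
Proof.
move=> iM jM; rewrite /inner.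
have E k : (k <= M)%N -> \sum_l v 0 l * (l.+1 == k.+1)%:R = coords v k.
  move=> kM; rewrite (bigD1 (inord k)) //= inordK // eqxx mulr1 big1 ?addr0 // => l.
  by rewrite -val_eqE /= inordK // eqSS => /negPf ->; rewrite mulr0.
by under eq_bigr do rewrite !mxE mulrBr; rewrite sumrB !E.
Qed.

Definition region_of x : set 'rV[R]_M.+1 := [set v | Vspace M.+1 v /\
  forall i j k, (i < j <= M)%N -> (k <= m)%N ->
    if x j + k%:R < x i then coords v j + k%:R < coords v i
    else coords v i < coords v j + k%:R].

Lemma region_ofP x v : generic m M x ->
  region_of x v <-> [/\ Vspace M.+1 v, generic m M (coords v)
                     & same_side m M (coords v) x].
Proof.
move=> gx; split=> [[Vv h]|[Vv gv s]].
  split=> // [i j ij|i j k ij /andP [_ km]].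
    split=> [|k km]; last by have := h i j k ij km; case: ifP => _; [move/gt_eqF->|move/lt_eqF->].
    by have := h i j 0%N ij; rewrite leq0n !addr0 (proj1 (gx _ _ ij)) => ->.
  by have := h i j k ij km; case: ifP => _ //; case: ltgtP.
split=> // i j k ij km; have := same_side0 gv gx s ij km.
by case: ifP => _ E; rewrite ?E // (generic_lt gv ij km) E.
Qed.

Lemma region_self v : Vspace M.+1 v -> generic m M (coords v) -> region_of (coords v) v.
Proof. by move=> Vv gv; apply/region_ofP. Qed.

Lemma row_of_lt x i j (c : R) : (i <= M)%N -> (j <= M)%N ->
  (coords (row_of x) j + c < coords (row_of x) i) = (x j + c < x i).
Proof. by move=> iM jM; rewrite !coords_row_of //; set s := _ / _; apply/idP/idP; lra. Qed.

Lemma region_row_of x : generic m M x -> region_of x (row_of x).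
Proof.
move=> gx; split; first exact: Vspace_row_of.
move=> i j k ij km; have [iM jM] : (i <= M)%N /\ (j <= M)%N by lia.
have E := generic_lt gx ij km; case: ifP => h; first by rewrite row_of_lt.
by move: E; rewrite h !coords_row_of //=; set s := _ / _; lra.
Qed.

Lemma region_of_same x z : generic m M x -> generic m M z ->
  region_of x = region_of z <-> same_side m M x z.
Proof.
move=> gx gz; split=> [E|s].
  have [_ _ s1] := (region_ofP _ gx).1 (region_row_of gx).
  have [_ _ s2] : [/\ Vspace M.+1 (row_of x), generic m M (coords (row_of x))
                     & same_side m M (coords (row_of x)) z].
    by apply/(region_ofP _ gz); rewrite -E; apply: region_row_of.
  exact: same_side_trans (same_side_sym s1) s2.
apply/seteqP; split=> v /(region_ofP _ _) h; apply/region_ofP => //.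
  by have [Vv gv s1] := h gx; split=> //; exact: same_side_trans s1 s.
by have [Vv gv s1] := h gz; split=> //; exact: same_side_trans s1 (same_side_sym s).
Qed.

Lemma convex_gt0 (a b t : R) : 0 < a -> 0 < b -> 0 <= t <= 1 -> 0 < (1 - t) * a + t * b.
Proof.
move=> a0 b0 /andP []; rewrite le_eqVlt => /orP [/eqP <-|t0] t1; first by lra.
by apply: ltr_wpDl; [apply: mulr_ge0; lra|exact: mulr_gt0].
Qed.

Lemma region_segment x v w t : region_of x v -> region_of x w -> 0 <= t <= 1 ->
  region_of x ((1 - t) *: v + t *: w).
Proof.
move=> [Vv hv] [Vw hw] t01; split; first exact: Vspace_comb.
move=> i j k ij km; rewrite !coords_comb.
have := hv i j k ij km; have := hw i j k ij km.
by case: ifP => _; rewrite -subr_gt0 => hw'; rewrite -subr_gt0 => hv';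
  have := convex_gt0 hv' hw' t01; lra.
Qed.

Lemma shi_complementP v : shi_complement M.+1 m v <-> Vspace M.+1 v /\
  forall i j (k : int), (i < j <= M)%N -> - m%:Z < k <= m%:Z ->
    coords v i - coords v j != k%:~R.
Proof.
split=> [[Vv nH]|[Vv h]]; split=> //.
  move=> i j k ij km; apply/eqP => E; apply: nH.
  exists (hyperplane (shi_root M.+1 i.+1 j) k); last first.
    by split=> //; rewrite inner_root //; lia.
  by exists i.+1, j, k; split=> //=; lia.
move=> [H [i [j [k [i1 ij jM km ->]]]] [_]].
case: i i1 ij => // i _ ij; rewrite inner_root; [|lia|lia].
by apply/eqP; apply: h => //; rewrite ij.
Qed.

Lemma generic_complement v : Vspace M.+1 v -> generic m M (coords v) ->
  shi_complement M.+1 m v.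
Proof.
move=> Vv gv; apply/shi_complementP; split=> // i j k ij /andP [_ km].
have [lt ne] := gv i j ij; case: k km => k km; last first.
  by rewrite gt_eqF // NegzE (lt_trans (y := 0)) ?subr_gt0 // rmorphN oppr_lt0 ltr0z.
by apply: contraNneq (ne k km) => E; apply/eqP; rewrite -pmulrn in E; lra.
Qed.

Lemma coords_diff_continuous i j : continuous (fun v => coords v i - coords v j).
Proof.
move=> v; apply: (@continuousB _ _ _ (fun v => coords v i) (fun v => coords v j));
  exact: coord_continuous.
Qed.

Lemma segment_continuous v w : continuous (fun t : R => (1 - t) *: v + t *: w).
Proof.
move=> t; apply: cvgD; last exact: scalel_continuous.
apply: cvgZr_tmp; apply: cvgB; [exact: cvg_cst|exact: cvg_id].
Qed.

Lemma dominant_chamberP v : dominant_chamber M.+1 v <->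
  Vspace M.+1 v /\ forall i j, (i <= j <= M)%N -> coords v j <= coords v i.
Proof.
split=> [[Vv h]|[Vv h]]; split=> //; last first.
  move=> [|i] //= iM; rewrite inner_root; [|lia|lia].
  by rewrite subr_ge0; apply: h; lia.
move=> i j /andP [ij]; move: ij => /subnK <-; elim: (j - i)%N => // d IH dM.
have := h (d + i).+1; rewrite inner_root; [|lia|lia].
rewrite subr_ge0 -addSn => h1; apply: le_trans (IH _); [apply: h1|]; lia.
Qed.

Hypothesis m_gt0 : (0 < m)%N.

(** A difference of coordinates maps a connected set to an interval, which cannot jump over a
    forbidden level. Conversely the region is convex, so segments join its points inside the
    complement. *)
Lemma component_region v : Vspace M.+1 v -> generic m M (coords v) ->
  connected_component (shi_complement M.+1 m) v = region_of (coords v).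
Proof.
move=> Vv gv; apply/seteqP; split=> w.
  move=> [C [Cv CS Cc] Cw]; have /shi_complementP [Vw _] := CS _ Cw.
  split=> // i j k ij km.
  have ci := connected_continuous_connected Cc
    (continuous_subspaceT (@coords_diff_continuous i j)).
  move/connected_intervalP: ci => ci.
  have nk : ~ ((fun v => coords v i - coords v j) @` C) k%:R.
    move=> [y /CS /shi_complementP [_ /(_ i j k%:Z ij)]].
    have -> : - m%:Z < k%:Z <= m%:Z by lia.
    by move=> /(_ isT) /eqP.
  have iv : ((fun v => coords v i - coords v j) @` C) (coords v i - coords v j) by exists v.
  have iw : ((fun v => coords v i - coords v j) @` C) (coords w i - coords w j) by exists w.
  case: ifP => h.
    rewrite ltNge; apply/negP => h'; apply: nk; apply: ci iw iv _ _.
    by apply/andP; split; lra.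
  rewrite ltNge; apply/negP => h'; apply: nk; apply: ci iv iw _ _.
  by apply/andP; split; lra.
move=> rw; exists ((fun t : R => (1 - t) *: v + t *: w) @` `[0, 1]%classic).
  split.
  - by exists 0; rewrite /= ?in_itv /= ?lexx ?ler01 // subr0 scale1r scale0r addr0.
  - move=> _ [t t01 <-]; move: t01; rewrite /= in_itv /= => t01.
    have [? ? _] := (region_ofP _ gv).1 (region_segment (region_self Vv gv) rw t01).
    exact: generic_complement.
  - apply: connected_continuous_connected.
      by apply/connected_intervalP; exact: interval_is_interval.
    exact/continuous_subspaceT/segment_continuous.
by exists 1; rewrite /= ?in_itv /= ?lexx ?ler01 // subrr scale0r scale1r add0r.
Qed.

Lemma dominant_regionP A : dominant_region M.+1 m A <->
  exists2 x, generic m M x & A = region_of x.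
Proof.
split=> [[[v Sv ->] dom]|[x gx ->]].
  have [Vv ne] := (shi_complementP v).1 Sv.
  have := dom v (connected_component_refl Sv) => /dominant_chamberP [_ le].
  have gv : generic m M (coords v).
    move=> i j ij; split=> [|k km].
      (* Since [0 < m], level 0 belongs to the arrangement, which makes the weak inequalities of the
         dominant chamber strict. *)
      have := ne i j 0 ij; rewrite oppr_lt0 ltz_nat m_gt0 /= subr_eq0 => /(_ isT) n0.
      by rewrite lt_neqAle eq_sym n0 le //; lia.
    apply/eqP => E; have := ne i j k%:Z ij.
    have -> : - m%:Z < k%:Z <= m%:Z by lia.
    by move=> /(_ isT) /eqP; apply; rewrite -pmulrn; lra.
  by exists (coords v) => //; exact: component_region.
have [Vx gv s] := (region_ofP _ gx).1 (region_row_of gx).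
split.
  exists (row_of x); first exact: generic_complement.
  by rewrite component_region //; apply/region_of_same => //; exact: same_side_sym.
move=> v /(region_ofP _ gx) [Vv gv' _]; apply/dominant_chamberP; split=> // i j ij.
exact: generic_le gv' ij.
Qed.

End Regions.

(** * Separating walls *)

Section Separation.
Variables (R : realType) (m M : nat).
Hypothesis m_gt0 : (0 < m)%N.
Hypothesis M_gt0 : (0 < M)%N.
Implicit Types (v w : 'rV[R]_M.+1) (x : nat -> R).

Lemma fund_alcove_sub v : fund_alcove M.+1 v -> closed_fund_alcove M.+1 v.
Proof. exact: (@interior_subset (subspace (Vspace M.+1))). Qed.

Lemma fund_alcove_le v i j : fund_alcove M.+1 v -> (i < j <= M)%N ->
  coords v i - coords v j <= 1.
Proof.
move=> /fund_alcove_sub [/dominant_chamberP [Vv le]].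
rewrite inner_root // => h ij.
have : coords v i <= coords v 0 by apply: le; lia.
have : coords v M <= coords v j by apply: le; lia.
by lra.
Qed.

Lemma fund_alcove_Vspace v : fund_alcove M.+1 v -> Vspace M.+1 v.
Proof. by move=> /fund_alcove_sub [[Vv _] _]. Qed.

Lemma fund_alcove_point : exists2 v : 'rV[R]_M.+1, fund_alcove M.+1 v &
  forall i j, (i < j <= M)%N -> coords v i - coords v j < 1.
Proof.
(* The differences of these coordinates are (j - i) / (M + 1), strictly between 0 and 1. *)
pose x (i : nat) : R := - (i%:R / M.+1%:R).
have xE i j : (i < j <= M)%N -> 0 < coords (row_of M x) i - coords (row_of M x) j < 1.
  move=> ij; rewrite !coords_row_of; [|lia|lia].
  have : (i%:R + 1 <= j%:R :> R) by rewrite natr1 ler_nat; lia.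
  have : (j%:R + 1 <= M.+1%:R :> R) by rewrite natr1 ler_nat; lia.
  have : 0 <= i%:R :> R by [].
  move=> ? ? ?; have -> : x i - (\sum_(l < M.+1) x l) / M.+1%:R -
      (x j - (\sum_(l < M.+1) x l) / M.+1%:R) = (j%:R - i%:R) / M.+1%:R.
    by rewrite /x mulrBl; set s := _ / _; set p := _ / _; set q := _ / _; lra.
  by rewrite divr_gt0 ?ltr0n ?ltr_pdivrMr ?ltr0n //=; lra.
exists (row_of M x); last by move=> i j /xE /andP [].
have Vx := @Vspace_row_of R M x.
rewrite /fund_alcove /interior /= /nbhs /= -nbhs_subspace_in //.
pose g (p : 'I_M.+1 * 'I_M.+1) : set 'rV[R]_M.+1 := [set v | (p.1 < p.2)%N ->
  0 < coords v p.1 - coords v p.2 < 1].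
have : nbhs (row_of M x) [set v | forall p, g p v].
  apply: (@filter_forall _ _ g (nbhs (row_of M x)) _) => [[i j]].
  have [ij|ij] := boolP (i < j)%N; last first.
    by rewrite /g /= (negPf ij); apply: filterE.
  have h : (i < j <= M)%N by rewrite ij -ltnS ltn_ord.
  have /andP [x0 x1] := xE _ _ h.
  have nb : nbhs (coords (row_of M x) i - coords (row_of M x) j) [set y | 0 < y < 1].
    apply: open_nbhs_nbhs; split; last by rewrite /= x0 x1.
    rewrite (_ : [set y | _] = [set y | 0 < y] `&` [set y | y < 1]).
      by apply: openI; [exact: open_gt|exact: open_lt].
    by apply/seteqP; split=> y /=; [move=> /andP []|move=> [-> ->]].
  have := @coords_diff_continuous R M i j (row_of M x) _ nb.
  by apply: (@filterS _ (nbhs (row_of M x)) _) => v hv _.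
apply: (@filterS _ (nbhs (row_of M x)) _) => v gv /= Vv.
have gE i j : (i < j <= M)%N -> 0 < coords v i - coords v j < 1.
  move=> /andP [ij jM]; have := gv (inord i, inord j).
  by rewrite /g /= !inordK ?ltnS // ?(leq_trans (ltnW ij)) //; apply.
split; last first.
  rewrite inner_root // ltW //; have := gE 0%N M.
  by rewrite M_gt0 leqnn => /(_ isT) /andP [].
apply/dominant_chamberP; split=> // i j /andP [].
rewrite leq_eqVlt => /orP [/eqP -> //|ij jM].
by have := gE i j; rewrite ij jM => /(_ isT); lra.
Qed.

(** On the alcove all differences are at most 1 <= k, and at one of its points they are less than 1.
    This fixes which half-space contains the alcove and leaves one orientation. *)
Lemma separatesP x i j k : generic m M x -> (i < j <= M)%N -> (0 < k <= m)%N ->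
  separates (shi_root M.+1 i.+1 j) k%:Z (@region_of R m M x) (fund_alcove M.+1) <->
  x j + k%:R < x i.
Proof.
move=> gx ij /andP [k0 km]; have [iM jM] : (i <= M)%N /\ (j <= M)%N by lia.
have k1 : 1 <= k%:R :> R by rewrite ler1n.
split=> [|h]; last first.
  right; split=> v; last first.
    move=> av; split; first exact: fund_alcove_Vspace.
    by rewrite inner_root // -pmulrn; have := fund_alcove_le av ij; lra.
  by move=> [Vv /(_ i j k ij km)]; rewrite h => lt; split=> //; rewrite inner_root // -pmulrn; lra.
have [v0 av0 lt0] := fund_alcove_point.
move=> [[_ sub]|[sub _]].
  by have [_] := sub _ av0; rewrite inner_root // -pmulrn; have := lt0 _ _ ij; lra.
have [_] := sub _ (region_row_of gx); rewrite inner_root // -pmulrn => h.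
have [_ /(_ i j k ij km)] := region_row_of gx; case: ifP => // _; lra.
Qed.

Lemma c_statE x : generic m M x -> c_stat M.+1 m (@region_of R m M x) = ccount m M x.
Proof.
move=> gx; rewrite /c_stat ccountE big_add1 big_mkord; apply: eq_bigr => i _.
rewrite big_add1 big_mkord; apply: eq_bigr => k _; congr nat_of_bool.
by apply/asboolP/idP => /separatesP; apply; rewrite ?ltn_ord ?leqnn.
Qed.

Lemma r_statE x : generic m M x -> r_stat M.+1 m (@region_of R m M x) = rcount m M x.
Proof.
move=> gx; rewrite /r_stat rcountE big_add1 big_mkord; apply: eq_bigr => i _.
rewrite big_add1 big_mkord; apply: eq_bigr => k _; congr nat_of_bool.
by apply/asboolP/idP => /separatesP; apply; rewrite ?ltn_ord ?leqnn.
Qed.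

End Separation.

(** * Facets on a hyperplane of level [m] and the generating function *)

Section Facets.
Variables (R : realType) (m M a b : nat).
Hypothesis m_gt0 : (0 < m)%N.
Hypothesis abM : (a < b <= M)%N.
Implicit Types (v w : 'rV[R]_M.+1) (x : nat -> R).

Let aM : (a <= M)%N. Proof. by lia. Qed.
Let bM : (b <= M)%N. Proof. by lia. Qed.

Let H : set 'rV[R]_M.+1 := hyperplane (shi_root M.+1 a.+1 b) m%:Z.

Let HP v : H v <-> Vspace M.+1 v /\ coords v a = coords v b + m%:R.
Proof.
rewrite /H /hyperplane /= inner_root // -pmulrn.
by split=> [[Vv E]|[Vv E]]; split=> //; lra.
Qed.

Lemma segment_closure (A : set 'rV[R]_M.+1) v w :
  (forall t, 0 < t <= 1 -> A ((1 - t) *: v + t *: w)) -> closure A v.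
Proof.
move=> h B nB.
have := @segment_continuous R M v w 0 B.
rewrite subr0 scale1r scale0r addr0 => /(_ nB) /nbhs_ballP [e /= e0 sub].
pose t := Num.min (e / 2) 1; have t01 : 0 < t <= 1.
  by rewrite /t lt_min ge_min lexx orbT ltr01 divr_gt0.
exists ((1 - t) *: v + t *: w); split; first exact: h.
apply: sub; rewrite /ball /= sub0r normrN gtr0_norm; last by case/andP: t01.
by rewrite /t gt_min ltr_pdivrMr // (_ : e < e * 2) //; lra.
Qed.

Lemma on_wall_closure x v : generic m M x -> x b + m%:R < x a ->
  Vspace M.+1 v -> on_wall m a b M x (coords v) -> closure (@region_of R m M x) v.
Proof.
move=> gx xab Vv [vE vs]; have [Vx hx] := region_row_of gx.
apply: (@segment_closure _ _ (row_of M x)) => t /andP [t0 t1].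
split; first exact: Vspace_comb.
move=> i j k ij km; have := hx i j k ij km; rewrite !coords_comb.
have [[-> -> ->]|/eqP ne] := (i, j, k) =P (a, b, m).
  by rewrite xab vE => h; nra.
have t01 : 0 <= t <= 1 by rewrite ltW.
have := vs i j k ij km ne.
by case: ifP => _; rewrite -subr_gt0 => h1; rewrite -subr_gt0 => h2;
  have := convex_gt0 h1 h2 t01; lra.
Qed.

Lemma on_wall_nearby x y (e : nat -> R) : on_wall m a b M x y -> e a = e b ->
  exists2 eps, 0 < eps & on_wall m a b M x (fun i => y i + eps * e i).
Proof.
move=> [yE ys] eE.
pose I := ('I_M.+1 * 'I_M.+1 * 'I_m.+1)%type.
pose s (t : I) : R := if x t.1.2 + t.2%:R < x t.1.1 then 1 else -1.
pose d (t : I) := s t * (y t.1.1 - y t.1.2 - t.2%:R).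
pose P (t : I) := (t.1.1 < t.1.2)%N &&
  ((nat_of_ord t.1.1, nat_of_ord t.1.2, nat_of_ord t.2) != (a, b, m)).
have [|eps e0 h] := @small_eps R I P d (fun t => s t * (e t.1.1 - e t.1.2)).
  move=> [[i j] k] /andP [/= ij ne].
  have := ys i j k; rewrite ij -ltnS ltn_ord -ltnS ltn_ord => /(_ isT isT ne).
  by rewrite /d /s /=; case: ifP; lra.
exists eps => //; split; first by rewrite yE eE; lra.
move=> i j k ij km ne.
have [iM jM] : (i < M.+1)%N /\ (j < M.+1)%N by lia.
have := h (Ordinal iM, Ordinal jM, Ordinal (km : k < m.+1)%N).
rewrite /P /d /s /= ne andbT; case/andP: ij => -> _ /(_ isT).
by case: ifP; lra.
Qed.

(** If the wall condition fails at [t] and [k], the two offending inequalities become equalities on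
    the face. The face then satisfies x_a - x_t = k, and so does its affine hull, which is too
    small. *)
Lemma facet_has_wall x : generic m M x -> x b + m%:R < x a ->
  affine_hull (closure (@region_of R m M x) `&` H) = H -> has_wall m a b x.
Proof.
move=> gx xab hull; split=> // t k /andP [at_ tb] km h1; apply/negP => h2.
have tM : (t <= M)%N by lia.
have onH v : (closure (@region_of R m M x) `&` H) v -> coords v a - coords v t = k%:R.
  move=> [cv /HP [_ vE]].
  have cl i j (c : nat) : (i < j <= M)%N -> (c <= m)%N -> x j + c%:R < x i ->
      c%:R <= coords v i - coords v j.
    move=> ij cm xc.
    have : closed ((fun v => coords v i - coords v j) @^-1` [set y | c%:R <= y]).
      apply: preimage_closed; last exact: closed_ge.
      by move=> w _; exact: coords_diff_continuous.
    move/closure_id => E.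
    have : closure ((fun v : 'rV[R]_M.+1 => coords v i - coords v j)
                      @^-1` [set y | c%:R <= y]) v.
      move: cv; apply: closureS => w [_ /(_ i j c ij cm)].
      by rewrite xc /=; lra.
    by rewrite -E.
  have := cl a t k; have := cl t b (m - k)%N; rewrite h1 h2 natrB // leq_subr km tb at_ bM tM.
  by move=> /(_ isT isT isT) ? /(_ isT isT isT) ?; lra.
(* A point of the hyperplane with z_a - z_t = k + 1, hence outside the supposed affine hull. *)
pose z i : R := if i == b then - m%:R else if i == t then - k.+1%:R else 0.
have za : z a = 0 by rewrite /z ltn_eqF ?(ltn_trans at_) // ltn_eqF.
have zb : z b = - m%:R by rewrite /z eqxx.
have zt : z t = - k.+1%:R by rewrite /z ltn_eqF // eqxx.
have : H (row_of M z).
  apply/HP; split; first exact: Vspace_row_of.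
  by rewrite !coords_row_of // za zb; set s := _ / _; lra.
rewrite -hull => - [d [y [c [yA c1 E]]]].
have : coords (row_of M z) a - coords (row_of M z) t = k%:R.
  have cE i : coords (row_of M z) i = \sum_t c t * coords (y t) i.
    by rewrite E /coords summxE; apply: eq_bigr => ? _; rewrite mxE.
  rewrite !cE -sumrB -[RHS]mul1r -[X in _ = X * _]c1 mulr_suml; apply: eq_bigr => l _.
  by rewrite -mulrBr (onH _ (yA l)).
by rewrite !coords_row_of // za zt -natr1; set s := _ / _; lra.
Qed.

(** From a relatively interior point [Y] of the face, a small move towards any [w] of the hyperplane
    stays in the face at some [W]; then [w] is an affine combination of [W] and [Y]. *)
Lemma has_wall_facet x : generic m M x -> has_wall m a b x ->
  affine_hull (closure (@region_of R m M x) `&` H) = H.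
Proof.
move=> gx wx; have xab := proj1 wx; apply/seteqP; split=> w.
  move=> [d [y [c [yA c1 ->]]]]; apply/HP; split.
    rewrite /Vspace /=; under eq_bigr do rewrite summxE.
    rewrite exchange_big big1 // => l _; under eq_bigr do rewrite mxE.
    by rewrite -mulr_sumr; have [_ /HP [-> _]] := yA l; rewrite mulr0.
  have cE i : coords (\sum_t c t *: y t) i = \sum_t c t * coords (y t) i.
    by rewrite /coords summxE; apply: eq_bigr => ? _; rewrite mxE.
  rewrite !cE -[m%:R]mul1r -[X in X * m%:R]c1 mulr_suml -big_split; apply: eq_bigr => l _ /=.
  by have [_ /HP [_ ->]] := yA l; rewrite mulrDr.
move=> /HP [Vw wE].
have [y0 wy0] := on_wall_ex m_gt0 abM gx wx.
pose Y := row_of M y0; have VY : Vspace M.+1 Y by exact: Vspace_row_of.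
have wY : on_wall m a b M x (coords Y).
  case: wy0 => yE ys; split; first by rewrite !coords_row_of // yE; set s := _ / _; lra.
  move=> i j k ij km ne; have := ys i j k ij km ne.
  rewrite !coords_row_of; [|lia|lia].
  by set s := _ / _; case: ifP => _; lra.
have [|eps e0 we] := on_wall_nearby (e := fun i => coords w i - coords Y i) wY.
  by rewrite wE (proj1 wY); lra.
pose W := (1 - eps) *: Y + eps *: w.
have cW i : coords W i = coords Y i + eps * (coords w i - coords Y i).
  by rewrite coords_comb; lra.
have {}we : on_wall m a b M x (coords W) by rewrite (funext cW).
have VW : Vspace M.+1 W by exact: Vspace_comb.
have mem v : Vspace M.+1 v -> on_wall m a b M x (coords v) ->
    (closure (@region_of R m M x) `&` H) v.
  by move=> Vv ov; split; [exact: on_wall_closure|apply/HP; case: ov].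
exists 2%N, (fun i : 'I_2 => if i == 0 then W else Y),
  (fun i : 'I_2 => if i == 0 then eps^-1 else 1 - eps^-1); split.
- by move=> i; case: ifP => _; exact: mem.
- by rewrite !big_ord_recl big_ord0 /= addr0 addrC subrK.
- rewrite !big_ord_recl big_ord0 /= addr0 /W scalerDr !scalerA mulVf ?gt_eqF //.
  rewrite scale1r mulrBr mulr1 mulVf ?gt_eqF // addrAC -scalerDl.
  by rewrite addrA subrK subrr scale0r add0r.
Qed.

Lemma separating_wallP x : generic m M x ->
  separating_wall m (shi_root M.+1 a.+1 b) m%:Z (@region_of R m M x) <-> has_wall m a b x.
Proof.
move=> gx; have M0 : (0 < M)%N by lia.
have mm : (0 < m <= m)%N by rewrite m_gt0 leqnn.
have sepP := separatesP m_gt0 M0 gx abM mm.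
split=> [[[_ [_ hull]] /sepP xab]|wx]; first exact: facet_has_wall.
split; last by apply/sepP; case: wx.
split; first by exists a.+1, b, m%:Z; split=> //=; lia.
split; last exact: has_wall_facet.
right=> v [Vv /(_ a b m abM (leqnn m))]; rewrite (proj1 wx) => h.
by split=> //; rewrite inner_root // -pmulrn; lra.
Qed.

(** Codes of points with the wall correspond bijectively to the regions being summed, so the sum
    over sets of vectors becomes a finite sum over codes. *)
Lemma genF_wall_sum : genF R M.+1 m a.+1 b = wall_sum R m M a b.
Proof.
have M0 : (0 < M)%N by lia.
pose P := [set t | exists x, walled m M a b x /\ tab m M x = t].
pose h t := if pselect (exists x, walled m M a b x /\ tab m M x = t) is left e
            then @region_of R m M (sval (cid e)) else set0.
have hE x : walled m M a b x -> h (tab m M x) = @region_of R m M x.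
  move=> wx; rewrite /h; case: pselect => [e|[]]; last by exists x.
  case: (cid e) => z /= [wz /tabP s]; apply/region_of_same => //.
    by case: wz.
  by case: wx.
rewrite /genF (_ : [set A | _] = h @` P); last first.
  apply/seteqP; split=> A.
    move=> [/dominant_regionP [//|x gx ->] /(separating_wallP gx) wx].
    exists (tab m M x); first by exists x.
    by rewrite hE.
  move=> [_ [x [wx <-]] <-]; rewrite hE //; have [gx wx'] := wx; split.
    by apply/dominant_regionP => //; exists x.
  exact/separating_wallP.
rewrite fsbig_image; last first.
  move=> t t'; rewrite !inE => - [x [wx <-]] [z [wz <-]]; rewrite !hE // => E.
  by apply/tabP; apply/region_of_same => //; [case: wx|case: wz].
rewrite /wall_sum /class_sum.
rewrite -[P]set_mem_set -(@bigfs _ _ _ _ (index_enum _)); last 2 first.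
- exact: index_enum_uniq.
- by move=> t _; rewrite mem_index_enum.
rewrite big_mkcond; apply: eq_bigr => t _; case: ifPn; last first.
  by rewrite notin_setE => n; rewrite class_val_out.
rewrite inE => - [x [wx <-]]; rewrite hE // class_valE //; last exact: weight_invariant.
by rewrite c_statE ?r_statE //; case: wx.
Qed.

End Facets.

Theorem theorem5p6 (R : realType) (m n u v : nat)
    (hm : (1 <= m)%N) (hn : (2 <= n)%N)
    (hu : (1 <= u)%N) (huv : (u <= v)%N) (hv : (v <= n - 1)%N) :
  genF R n m u v =
  phi_comp m (v + 2) n
    (rho (phi_comp m (v - u + 3) (v + 1)
            (pvar ^+ m * qvar ^+ m * bracket_pq m ^+ (v - u)))).
Proof.
case: n hn hv => // M _; rewrite subn1 /= => vM.
case: u hu huv => // a _ av.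
have avM : (a < v <= M)%N by rewrite av.
have avv : (a < v <= v)%N by rewrite av leqnn.
have dv : (0 < (v - a.+1).+1 <= v)%N by lia.
(* Removing the coordinates after index [v] makes the wall end at the last one; after reflection it
   starts at index 0. Removing coordinates again leaves the highest root with [v - u] interior
   coordinates. *)
rewrite genF_wall_sum // -(phi_comp_wall_sum R avM) // wall_sum_reflect // subnn.
have -> : (v - a)%N = (v - a.+1).+1 by lia.
by rewrite -(phi_comp_wall_sum R dv) // wall_sum_highest // addn2 addn1 addn3.
Qed.
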